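(* Let $(M,\alpha)$ be a strict contact manifold. The map $$\Phi:(\mathcal{C}^\infty(M,\mathbb{R}),[\cdot,\cdot])\to(\mathcal{X}_{con}(M,\ker\alpha),[\cdot,\cdot]),\qquad f\mapsto X_f,$$ is a Lie algebra isomorphism, where the bracket on the left is the Jacobi bracket and the bracket on the right is the Lie bracket of vector fields.
   Context: A strict contact manifold $(M,\alpha)$ is a $(2n+1)$-dimensional smooth manifold $M$ with a smooth 1-form $\alpha$ such that $\alpha\wedge(d\alpha)^n$ is nowhere zero. The Reeb vector field $R_\alpha$ is the unique vector field with $\iota_{R_\alpha}d\alpha=0$ and $\alpha(R_\alpha)=1$. For a smooth function $H$ on $M$, the contact Hamiltonian vector field $X_H$ is the unique vector field with $\alpha(X_H)=H$ and $\iota_{X_H}d\alpha=dH(R_\alpha)\alpha-dH$. The Jacobi bracket of $f,g\in\mathcal{C}^\infty(M,\mathbb{R})$ is $[f,g]=\alpha([X_f,X_g])$, with $[X_f,X_g]$ the Lie bracket of vector fields. $\mathcal{X}_{con}(M,\ker\alpha)$ is the set of contact vector fields, i.e. vector fields whose (local) flow preserves $\ker\alpha$; equivalently vector fields $X$ with $\mathcal{L}_X\alpha=\mu\alpha$ for some smooth function $\mu:M\to\mathbb{R}$. It is closed under the Lie bracket of vector fields. Lie algebras are over $\mathbb{R}$. *)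

(* Defs.v *)
(* MathComp-Analysis *)
From mathcomp Require Import all_boot all_order all_algebra all_fingroup.
From mathcomp Require Import all_classical all_reals all_analysis.

Set Implicit Arguments.
Unset Strict Implicit.
Unset Printing Implicit Defensive.

Import Order.TTheory GRing.Theory Num.Theory.
Import numFieldNormedType.Exports.
Local Open Scope classical_set_scope.
Local Open Scope ring_scope.

Section smooth.
Context {R : realType} {V W : normedModType R}.

Fixpoint diff_times (k : nat) (U : set V) (f : V -> W) : Prop :=
  if k is k'.+1 then
    (forall x, U x -> differentiable f x) /\
    (forall v, diff_times k' U (fun x => 'D_v f x))
  else True.

(* U is meant to be open *)
Definition smooth_on (U : set V) (f : V -> W) : Prop :=
  forall k, diff_times k U f.

End smooth.

(* A homeomorphism from an open set of M onto an open set of R^m; the values of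
   chart_map outside chart_dom, and of chart_inv outside the image, are junk. *)
Record chart (R : realType) (m : nat) (M : topologicalType) := Chart {
  chart_dom : set M ;
  chart_map : M -> 'rV[R]_m ;
  chart_inv : 'rV[R]_m -> M ;
  chart_dom_open : open chart_dom ;
  chart_img_open : open (chart_map @` chart_dom) ;
  chart_mapK : {in chart_dom, cancel chart_map chart_inv} ;
  chart_map_continuous : {within chart_dom, continuous chart_map} ;
  chart_inv_continuous :
    {within chart_map @` chart_dom, continuous chart_inv} }.

Definition chart_img (R : realType) (m : nat) (M : topologicalType)
  (c : chart R m M) : set 'rV[R]_m := chart_map c @` chart_dom c.

(* The atlas is not required to be maximal.  chart_at selects a preferred chart
   around each point; it only serves to represent tangent vectors (see
   vector_field below). *)
Record manifold (R : realType) (m : nat) := Manifold {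
  carrier :> topologicalType ;
  manifold_hausdorff : hausdorff_space carrier ;
  manifold_second_countable : @second_countable carrier ;
  atlas : set (chart R m carrier) ;
  chart_at : carrier -> chart R m carrier ;
  chart_at_atlas : forall p, atlas (chart_at p) ;
  chart_at_dom : forall p, chart_dom (chart_at p) p ;
  atlas_compatible : forall c d, atlas c -> atlas d ->
    smooth_on (chart_map c @` (chart_dom c `&` chart_dom d))
              (chart_map d \o chart_inv c) }.

Section alternating.
Context {R : realType} {E : Type}.

Definition form (k : nat) := ('I_k -> E) -> R.

Definition wedge (k l : nat) (a : form k) (b : form l) : form (k + l) :=
  fun v => (k`! * l`!)%:R^-1 *
    \sum_(s : 'S_(k + l)) (-1) ^+ s *
      (a (fun i => v (s (lshift l i))) * b (fun j => v (s (rshift k j)))).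

Fixpoint wedge_pow (b : form 2) (n : nat) : form (n * 2) :=
  if n is n'.+1 then wedge b (@wedge_pow b n') else fun=> 1.

End alternating.
Arguments wedge_pow {R E} b n.

Section calculus.
Context {R : realType} {m : nat} {M : manifold R m}.
Local Notation E := 'rV[R]_m.

Definition smooth_functions : set (M -> R) :=
  [set f : M -> R | forall c, atlas c -> smooth_on (chart_img c) (f \o chart_inv c)].

(* The tangent space at p is R^m: a tangent vector at p is given by its
   components in the chart chart_at p.  Fields are arbitrary here; smoothness
   is a separate predicate. *)
Definition vector_field := M -> E.
Definition one_form := M -> {linear E -> R}.

(* components in the chart d of the tangent vector at p whose components in
   the chart c are v *)
Definition coord_change (c d : chart R m M) (p : M) (v : E) : E :=
  'd (chart_map d \o chart_inv c) (chart_map c p) v.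

Definition local_vf (c : chart R m M) (X : vector_field) (x : E) : E :=
  let p := chart_inv c x in coord_change (chart_at p) c p (X p).

Definition local_form (c : chart R m M) (a : one_form) (w x : E) : R :=
  let p := chart_inv c x in a p (coord_change c (chart_at p) p w).

Definition smooth_vf (X : vector_field) : Prop :=
  forall c, atlas c -> smooth_on (chart_img c) (local_vf c X).

Definition smooth_form (a : one_form) : Prop :=
  forall c w, atlas c -> smooth_on (chart_img c) (local_form c a w).

Definition dfun (f : M -> R) (p : M) (v : E) : R :=
  let c := chart_at p in 'D_v (f \o chart_inv c) (chart_map c p).

(* (d a)_{kl} = d_k a_l - d_l a_k *)
Definition dform (a : one_form) (p : M) (v w : E) : R :=
  let c := chart_at p in let x := chart_map c p in
  'D_v (local_form c a w) x - 'D_w (local_form c a v) x.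

(* [X, Y]^k = X^l d_l Y^k - Y^l d_l X^k *)
Definition lie_bracket (X Y : vector_field) : vector_field := fun p =>
  let c := chart_at p in let x := chart_map c p in
  'D_(X p) (local_vf c Y) x - 'D_(Y p) (local_vf c X) x.

(* (L_X a)_k = X^l d_l a_k + a_l d_k X^l *)
Definition lie_derivative (X : vector_field) (a : one_form) (p : M) (w : E)
    : R :=
  let c := chart_at p in let x := chart_map c p in
  'D_(X p) (local_form c a w) x + a p ('D_w (local_vf c X) x).

End calculus.
Arguments vector_field {R m} M.
Arguments one_form {R m} M.
Arguments smooth_functions {R m} M.

Section contact.
Context {R : realType} {n : nat} {M : manifold R n.*2.+1}.
Local Notation E := 'rV[R]_(n.*2.+1).
Implicit Types (a : one_form M) (f g H : M -> R) (X Y : vector_field M).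

Definition contact_form a : Prop :=
  smooth_form a /\
  forall p, exists v : 'I_(1 + n * 2) -> E,
    wedge (fun u : 'I_1 -> E => a p (u ord0))
          (wedge_pow (fun u => dform a p (u ord0) (u ord_max)) n) v != 0.

Definition is_reeb a X : Prop :=
  [/\ smooth_vf X, forall p v, dform a p (X p) v = 0
    & forall p, a p (X p) = 1].

Definition reeb a : vector_field M := xget (fun=> 0) [set X | is_reeb a X].

Definition is_contact_hamiltonian a H X : Prop :=
  [/\ smooth_vf X, forall p, a p (X p) = H p
    & forall p v,
        dform a p (X p) v = dfun H p (reeb a p) * a p v - dfun H p v].

Definition contact_hamiltonian a H : vector_field M :=
  xget (fun=> 0) [set X | is_contact_hamiltonian a H X].

Definition jacobi_bracket a f g : M -> R := fun p =>
  a p (lie_bracket (contact_hamiltonian a f) (contact_hamiltonian a g) p).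

Definition contact_vector_fields a : set (vector_field M) :=
  [set X | smooth_vf X /\
    exists2 mu : M -> R, smooth_functions M mu &
      forall p w, lie_derivative X a p w = mu p * a p w].

End contact.

(* S, as a linear subspace of V, is a Lie algebra for the bracket br *)
Record lie_algebra (R : realType) (V : lmodType R) (S : set V)
    (br : V -> V -> V) : Prop := LieAlgebra {
  lie_0 : S 0 ;
  lie_lin : forall (k : R) x y, S x -> S y -> S (k *: x + y) ;
  lie_closed : forall x y, S x -> S y -> S (br x y) ;
  lie_linl : forall (k : R) x y z, S x -> S y -> S z ->
    br (k *: x + y) z = k *: br x z + br y z ;
  lie_linr : forall (k : R) x y z, S x -> S y -> S z ->
    br z (k *: x + y) = k *: br z x + br z y ;
  lie_alt : forall x, S x -> br x x = 0 ;
  lie_jacobi : forall x y z, S x -> S y -> S z ->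
    br x (br y z) + br y (br z x) + br z (br x y) = 0 }.

Record lie_isomorphism (R : realType) (V W : lmodType R)
    (S : set V) (brS : V -> V -> V) (T : set W) (brT : W -> W -> W)
    (phi : V -> W) : Prop := LieIsomorphism {
  iso_source : lie_algebra S brS ;
  iso_target : lie_algebra T brT ;
  iso_bij : set_bij S T phi ;
  iso_linear : forall (k : R) x y, S x -> S y ->
    phi (k *: x + y) = k *: phi x + phi y ;
  iso_bracket : forall x y, S x -> S y -> phi (brS x y) = brT (phi x) (phi y) }.

(* Main.v *)
Require Import Defs.
From mathcomp Require Import all_boot all_order all_algebra all_fingroup.
From mathcomp Require Import all_classical all_reals all_analysis.
Import numFieldNormedType.Exports.
From HB Require Import structures.
From mathcomp Require Import ring lra.

Set Implicit Arguments.
Unset Strict Implicit.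
Unset Printing Implicit Defensive.

Import Order.TTheory GRing.Theory Num.Theory.
Local Open Scope classical_set_scope.
Local Open Scope ring_scope.

(** Write alpha for the contact form and R for its Reeb field.  The inverse of
f |-> X_f is X |-> alpha(X).

At each point, the condition that alpha /\ (d alpha)^n does not vanish says that
no nonzero vector is killed by both alpha and d alpha
(wedge_nondegenerate).  Hence u |-> alpha(u) alpha + d alpha(u, .) is an
isomorphism onto covectors (gram_det), and a vector is determined by its
contractions with alpha and d alpha (contact_pair_inj).  Because d alpha is
antisymmetric in odd dimension it has a kernel, which provides R
(exists_reeb_vector); the equations defining X_H are then solvable at each
point, since the covector dH(R) alpha - dH vanishes on R (solve_contact_pair).
In a chart these are linear equations with smooth coefficients, so Cramer's
rule makes their solution smooth (smooth_vf_of_contractions).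

Cartan's formula L_X alpha = d alpha(X, .) + d(alpha(X)) (cartan) translates
between the two kinds of fields.  If X = X_f it gives L_X alpha = df(R) alpha,
so X is contact.  If L_X alpha = mu alpha, evaluating at R gives
mu = d(alpha(X))(R), so X is the Hamiltonian field of alpha(X).  Thus
f |-> X_f is a linear bijection onto the contact fields.  These are closed under
the Lie bracket, because L_X alpha = mu alpha and L_Y alpha = nu alpha imply
L_[X,Y] alpha = (X nu - Y mu) alpha (lie_bracket_conformal).  Consequently
[X_f, X_g] is the Hamiltonian field of alpha([X_f, X_g]), the Jacobi bracket of f
and g, and the Lie algebra axioms on functions are those of vector fields
transported along alpha.

The brackets and derivatives at p are defined in the preferred chart at p,
which varies with p.  To differentiate such expressions again they have to be
rewritten in one fixed chart near p (lie_bracket_local, dform_local,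
lie_derivative_local).  In each case the change of chart produces an additional
term built from the second derivative of the transition map, and these terms
cancel because that derivative is symmetric (schwarz_row). *)

(** * Locality and coordinates of derivatives *)

Section differentiation.
Context {R : realType}.
Implicit Types V W : normedModType R.

Lemma open_near_eq (T : topologicalType) (S : Type) (U : set T) (f g : T -> S) x :
  open U -> (forall y, U y -> f y = g y) -> U x -> \near x, f x = g x.
Proof. by move=> oU fg Ux; apply: filterS (open_nbhs_nbhs (conj oU Ux)). Qed.

(** The differential is obtained by choice from the first-order expansion, so
that it depends only on the germ of the map has to be deduced from uniqueness of
the expansion. *)
Lemma near_eq_diff V W (f g : V -> W) x : (\near x, f x = g x) ->
  differentiable f x -> differentiable g x /\ 'd g x = 'd f x :> (V -> W).
Proof.
move=> fg df.
have fx : f x = g x := nbhs_singleton fg.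
have cd : continuous ('d f x) by exact: diff_continuous.
have E : g \o shift x = cst (g x) + 'd f x +o_ 0 id.
  apply/eqaddoP => e e0.
  have /diff_locallyP[_ /eqaddoP/(_ e e0)] := df.
  apply: filter_app.
  have : \forall y \near 0, f (y + x) = g (y + x).
    by move: fg; rewrite (near_shift 0) subr0.
  by apply: filterS => y /= E; rewrite /= !fctE /= -E -fx.
have dg := diff_unique cd E.
have dfg : differentiable g x by apply/diff_locallyP; rewrite dg.
exact: conj dfg dg.
Qed.

Lemma near_eq_differentiable V W (f g : V -> W) x : (\near x, f x = g x) ->
  differentiable f x -> differentiable g x.
Proof. by move=> fg /(near_eq_diff fg)[]. Qed.

Lemma differentiable_row V m (f : V -> 'rV[R]_m) x :
  (forall j, differentiable (fun y => f y 0 j) x) -> differentiable f x.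
Proof.
move=> df.
have -> : f = \sum_(j < m) (fun y => f y 0 j *: delta_mx 0 j).
  apply/funext => y; rewrite fct_sumE [LHS]row_sum_delta.
  exact: eq_bigr.
by apply: differentiable_sum => j; apply: differentiableZl.
Qed.

Lemma differentiable_entry V m (f : V -> 'rV[R]_m) x j :
  differentiable f x -> differentiable (fun y => f y 0 j) x.
Proof.
move=> df; apply: (@differentiable_comp _ _ _ _ f (fun N : 'rV[R]_m => N 0 j)) => //.
exact: differentiable_coord.
Qed.

Lemma derive_entry V m (f : V -> 'rV[R]_m) x v j : differentiable f x ->
  ('D_v f x) 0 j = 'D_v (fun y => f y 0 j) x.
Proof. by move=> df; rewrite derive_mx ?mxE//; apply: diff_derivable. Qed.

Lemma derive_comp V W (Z : normedModType R) (f : V -> W) (g : W -> Z) x v :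
  differentiable f x -> differentiable g (f x) ->
  'D_v (fun y => g (f y)) x = 'D_('D_v f x) g (f x).
Proof.
move=> df dg; rewrite deriveE; last exact: (@differentiable_comp _ _ _ _ f g).
by rewrite (diff_comp df dg) /= -!deriveE.
Qed.

End differentiation.

(** * Algebraic operations on smooth maps *)

Section diff_times.
Context {R : realType} {V : normedModType R} (U : set V) (oU : open U).
Implicit Types W : normedModType R.

(** Openness of the domain is what makes the successive derivatives of f and g
agree as well. *)
Lemma eq_diff_times W k (f g : V -> W) : (forall x, U x -> f x = g x) ->
  diff_times k U f -> diff_times k U g.
Proof.
elim: k f g => // k IH f g fg /= [df Df]; split.
  by move=> x Ux; apply: near_eq_differentiable (df x Ux); exact: open_near_eq oU fg Ux.
move=> v; apply: (IH (fun x => 'D_v f x)) (Df v) => x Ux.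
by apply: near_eq_derive; exact: open_near_eq oU fg Ux.
Qed.

Lemma diff_timesW W k (f : V -> W) : diff_times k.+1 U f -> diff_times k U f.
Proof.
elim: k f => // k IH f [df Df]; split => // v.
exact/IH/Df.
Qed.

Lemma diff_times_cst W k (w : W) : diff_times k U (fun=> w).
Proof.
elim: k w => // k IH w; split; first by move=> x _; exact: differentiable_cst.
move=> v; apply: (eq_diff_times _ (IH 0)) => x _.
by rewrite -[RHS]/('D_v (cst w) x) derive_cst.
Qed.

Lemma diff_timesD W k (f g : V -> W) : diff_times k U f -> diff_times k U g ->
  diff_times k U (fun x => f x + g x).
Proof.
elim: k f g => // k IH f g [df Df] [dg Dg]; split.
  by move=> x Ux; apply: (@differentiableD _ _ _ f g); [exact: df|exact: dg].
move=> v; apply: eq_diff_times (IH _ _ (Df v) (Dg v)) => x Ux.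
by rewrite -[RHS]/('D_v (f + g) x) deriveD//; apply: diff_derivable; [exact: df|exact: dg].
Qed.

Lemma diff_timesZ W k (c : R) (f : V -> W) : diff_times k U f ->
  diff_times k U (fun x => c *: f x).
Proof.
elim: k f => // k IH f [df Df]; split.
  by move=> x Ux; apply: (@differentiableZ _ _ _ f); exact: df.
move=> v; apply: eq_diff_times (IH _ (Df v)) => x Ux.
by apply/esym/deriveZ/diff_derivable; exact: df.
Qed.

Lemma diff_times_sum W k (I : Type) (r : seq I) (P : pred I) (f : I -> V -> W) :
  (forall i, P i -> diff_times k U (f i)) ->
  diff_times k U (fun x => \sum_(i <- r | P i) f i x).
Proof.
move=> df; elim: r => [|i r IH].
  by apply: (eq_diff_times _ (@diff_times_cst W k 0)) => x _; rewrite big_nil.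
case Pi : (P i).
  by apply: (eq_diff_times _ (diff_timesD (df i Pi) IH)) => x _; rewrite big_cons Pi.
by apply: (eq_diff_times _ IH) => x _; rewrite big_cons Pi.
Qed.

Lemma diff_timesM k (f g : V -> R) : diff_times k U f -> diff_times k U g ->
  diff_times k U (fun x => f x * g x).
Proof.
elim: k f g => // k IH f g df' dg'; have [df Df] := df'; have [dg Dg] := dg'.
split.
  by move=> x Ux; apply: (@differentiableM _ _ f g); [exact: df|exact: dg].
move=> v; have := diff_timesD (IH _ _ (diff_timesW df') (Dg v))
  (IH _ _ (diff_timesW dg') (Df v)).
apply: eq_diff_times => x Ux.
by rewrite -[RHS]/('D_v (f * g) x) deriveM//; apply: diff_derivable; [exact: df|exact: dg].
Qed.

Lemma diff_times_prod k (I : Type) (r : seq I) (P : pred I) (f : I -> V -> R) :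
  (forall i, P i -> diff_times k U (f i)) ->
  diff_times k U (fun x => \prod_(i <- r | P i) f i x).
Proof.
move=> df; elim: r => [|i r IH].
  by apply: (eq_diff_times _ (@diff_times_cst R k 1)) => x _; rewrite big_nil.
case Pi : (P i).
  by apply: (eq_diff_times _ (diff_timesM (df i Pi) IH)) => x _; rewrite big_cons Pi.
by apply: (eq_diff_times _ IH) => x _; rewrite big_cons Pi.
Qed.

Lemma diff_timesV k (f : V -> R) : (forall x, U x -> f x != 0) ->
  diff_times k U f -> diff_times k U (fun x => (f x)^-1).
Proof.
move=> f0; elim: k => // k IH df'; have [df Df] := df'.
split; first by move=> x Ux; apply: (@differentiableV _ _ f); [exact: df|exact: f0].
move=> v; have IV := IH (diff_timesW df').
have := diff_timesM (@diff_times_cst R k (-1)) (diff_timesM (diff_timesM IV IV) (Df v)).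
apply: eq_diff_times => x Ux.
rewrite -[RHS]/('D_v (fun y => (f y)^-1) x) deriveV; first last.
- by apply: diff_derivable; exact: df.
- exact: f0.
by rewrite mulN1r -exprVn expr2 -mulNr.
Qed.

Lemma diff_times_row k m (f : V -> 'rV[R]_m) :
  diff_times k U f <-> forall j, diff_times k U (fun x => f x 0 j).
Proof.
elim: k f => [|k IH] f; first by split.
split => [[df Df] j|H].
  split; first by move=> x Ux; apply: differentiable_entry; exact: df.
  move=> v; have /IH/(_ j) := Df v; apply: eq_diff_times => x Ux.
  by rewrite derive_entry//; exact: df.
have df x : U x -> differentiable f x.
  by move=> Ux; apply: differentiable_row => j; have [+ _] := H j; exact.
split => // v; apply/IH => j; have [_ /(_ v)] := H j; apply: eq_diff_times => x Ux.
by rewrite derive_entry//; exact: df.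
Qed.

End diff_times.

Section directions.
Context {R : realType} {V : normedModType R}.
Implicit Types W : normedModType R.

Lemma derive_lindir W (g : V -> W) x k u v : differentiable g x ->
  'D_(k *: u + v) g x = k *: 'D_u g x + 'D_v g x.
Proof. by move=> dg; rewrite !deriveE// linearP. Qed.

Lemma deriveBdir W (g : V -> W) x u v : differentiable g x ->
  'D_(u - v) g x = 'D_u g x - 'D_v g x.
Proof. by move=> dg; rewrite !deriveE// linearB. Qed.

End directions.

(** * Families of linear maps along a vector-valued function *)

Section families.
Context {R : realType} {V : normedModType R}.

Lemma linear_row_sum m (W : lmodType R) (B : 'rV[R]_m -> W) u : linear B ->
  B u = \sum_(j < m) u 0 j *: B (delta_mx 0 j).
Proof.
move=> linB; pose LB := GRing.isLinear.Build _ _ _ _ B linB.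
pose L : {linear 'rV[R]_m -> W} := HB.pack B LB.
rewrite -[B]/(L : _ -> _) {1}[u]row_sum_delta linear_sum.
by apply: eq_bigr => j _; rewrite linearZ.
Qed.

Lemma diff_times_family k m (U : set V) (B : V -> 'rV[R]_m -> R)
    (Y : V -> 'rV[R]_m) : open U -> (forall x, linear (B x)) ->
  (forall w, diff_times k U (B ^~ w)) -> diff_times k U Y ->
  diff_times k U (fun x => B x (Y x)).
Proof.
move=> oU linB dB /(diff_times_row oU) dY.
have S : diff_times k U (fun x => \sum_(j < m) Y x 0 j * B x (delta_mx 0 j)).
  by apply: diff_times_sum => // j _; apply: diff_timesM.
by apply: (eq_diff_times oU _ S) => x _; rewrite [RHS]linear_row_sum.
Qed.

Lemma linear_entry m n (B : 'rV[R]_m -> 'rV[R]_n) j : linear B ->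
  linear (fun w => B w 0 j).
Proof. by move=> linB a u v; rewrite linB !mxE. Qed.

Lemma diff_times_family_row k m n (U : set V) (B : V -> 'rV[R]_m -> 'rV[R]_n)
    (Y : V -> 'rV[R]_m) : open U -> (forall x, linear (B x)) ->
  (forall w, diff_times k U (B ^~ w)) -> diff_times k U Y ->
  diff_times k U (fun x => B x (Y x)).
Proof.
move=> oU linB dB dY; apply/(diff_times_row oU) => j.
apply: (diff_times_family (B := fun x w => B x w 0 j)) => //.
  by move=> x; exact: linear_entry.
by move=> w; have /(diff_times_row oU)/(_ j) := dB w.
Qed.

(** Leibniz rule for the evaluation of a point-dependent linear map on a
point-dependent vector.  It serves for differentials 'd phi y (X y) as well as
for one-forms evaluated on vector fields.  In coordinates it is the product rule
applied to the sum of the Y_j * B e_j. *)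
Lemma leibniz_family m (B : V -> 'rV[R]_m -> R) (Y : V -> 'rV[R]_m) x v :
  (forall x, linear (B x)) -> (forall w, differentiable (B ^~ w) x) ->
  differentiable Y x ->
  differentiable (fun y => B y (Y y)) x /\
  'D_v (fun y => B y (Y y)) x = 'D_v (B ^~ (Y x)) x + B x ('D_v Y x).
Proof.
move=> linB dB dY.
have YE (Z : V -> 'rV[R]_m) : (fun y => B y (Z y)) =
    \sum_(j < m) ((fun y => Z y 0 j) * (B ^~ (delta_mx 0 j))).
  by apply/funext => y; rewrite fct_sumE [LHS]linear_row_sum.
have dYj j : differentiable (fun y => Y y 0 j) x by exact: differentiable_entry.
split; first by rewrite YE; apply: differentiable_sum => j; exact: differentiableM.
rewrite YE derive_sum; last first.
  by move=> j; apply: diff_derivable; exact: differentiableM.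
rewrite (YE (fun=> Y x)) derive_sum; last first.
  move=> j; apply: diff_derivable; apply: differentiableM; last exact: dB.
  exact: (differentiable_cst (Y x 0 j)).
rewrite (linear_row_sum ('D_v Y x) (linB x)) -big_split.
apply: eq_bigr => j _ /=.
rewrite !deriveM; try (by apply: diff_derivable);
  try by apply/diff_derivable/differentiable_cst.
rewrite -[fun _ => Y x 0 j]/(cst (Y x 0 j)) derive_cst scaler0 addr0 derive_entry//.
by congr (_ + _); exact: mulrC.
Qed.

Lemma leibniz_family_row m n (B : V -> 'rV[R]_m -> 'rV[R]_n)
    (Y : V -> 'rV[R]_m) x v :
  (forall x, linear (B x)) -> (forall w, differentiable (B ^~ w) x) ->
  differentiable Y x ->
  differentiable (fun y => B y (Y y)) x /\
  'D_v (fun y => B y (Y y)) x = 'D_v (B ^~ (Y x)) x + B x ('D_v Y x).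
Proof.
move=> linB dB dY.
have H j := leibniz_family v (fun x => linear_entry j (linB x))
  (fun w => differentiable_entry j (dB w)) dY.
have dd : differentiable (fun y => B y (Y y)) x.
  by apply: differentiable_row => j; have [] := H j.
split => //; apply/rowP => j; rewrite !mxE !derive_entry//.
by have [] := H j.
Qed.

End families.

(** * Symmetry of second derivatives *)

Section schwarz.
Context {R : realType} {V : normedModType R}.

Lemma is_derive_line (f : V -> R) a v s : differentiable f (s *: v + a) ->
  is_derive s 1 (fun t : R => f (t *: v + a)) ('D_v f (s *: v + a)).
Proof.
move=> df.
have [dl lE] : is_diff s (fun t : R => t *: v + a) (fun t => t *: v).
  have := @is_diffD _ _ _ (fun t : R => t *: v) (cst a) (fun t => t *: v) 0 s.
  by rewrite addr0; apply.
have L1 : 'D_1 (fun t : R => t *: v + a) s = v by rewrite deriveE// lE scale1r.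
split.
  apply: diff_derivable.
  exact: (@differentiable_comp _ _ _ _ (fun t : R => t *: v + a) f).
by rewrite (@derive_comp _ _ _ _ (fun t : R => t *: v + a) f)// L1.
Qed.

(** Two applications of the mean value theorem, first along v and then along w.
The second difference does not change when v and w are exchanged, which
gives the symmetry of second derivatives in the limit. *)
Lemma second_difference (U : set V) (f : V -> R) x v w (h : R) : 0 <= h ->
  (forall s t, s \in `[0, h] -> t \in `[0, h] -> U (t *: w + (s *: v + x))) ->
  (forall y, U y -> differentiable f y) ->
  (forall y, U y -> differentiable (fun z => 'D_v f z) y) ->
  exists s t, [/\ s \in `[0, h], t \in `[0, h] &
    f (h *: w + (h *: v + x)) - f (h *: w + x) - (f (h *: v + x) - f x) =
    'D_w (fun z => 'D_v f z) (t *: w + (s *: v + x)) * h * h].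
Proof.
move=> h0 HU df Ddf.
have h0in : 0 \in `[0, h] by rewrite in_itv /= lexx.
have hhin : h \in `[0, h] by rewrite in_itv /= lexx andbT.
pose g := fun s : R => f (s *: v + (h *: w + x)) - f (s *: v + x).
pose dg := fun s : R => 'D_v f (s *: v + (h *: w + x)) - 'D_v f (s *: v + x).
have Dg s : s \in `[0, h] -> is_derive s 1 g (dg s).
  move=> sh; apply: is_deriveB; apply: is_derive_line; apply: df.
    by rewrite addrCA; exact: HU.
  by have := HU _ _ sh h0in; rewrite scale0r add0r.
have [|s sh gE] := MVT_segment h0 (fun s sh => Dg s (subset_itv_oo_cc sh)).
  by apply: derivable_within_continuous => s sh; have [] := Dg s sh.
pose k := fun t : R => 'D_v f (t *: w + (s *: v + x)).
have Dk t : t \in `[0, h] ->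
    is_derive t 1 k ('D_w (fun z => 'D_v f z) (t *: w + (s *: v + x))).
  by move=> th; apply: (@is_derive_line (fun z => 'D_v f z)); apply/Ddf/HU.
have [|t th kE] := MVT_segment h0 (fun s sh => Dk s (subset_itv_oo_cc sh)).
  by apply: derivable_within_continuous => t th; have [] := Dk t th.
exists s, t; split => //.
move: gE kE; rewrite /g /k /dg !subr0 !scale0r !add0r => gE kE.
rewrite -kE [f (h *: w + (h *: v + x))](_ : _ = f (h *: v + (h *: w + x))); last first.
  by congr f; rewrite addrCA.
rewrite [h *: w + (s *: v + x)]addrCA -gE !opprB.
by rewrite addrACA [RHS]addrACA; congr (_ + _); exact: addrC.
Qed.

(** Two continuous functions that share a value at nearby points agree in the
limit; the points may differ for the two functions. *)
Lemma continuous_meet_eq (T : topologicalType) (F G : T -> R) x :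
  {for x, continuous F} -> {for x, continuous G} ->
  (forall N, nbhs x N -> exists z z', [/\ N z, N z' & F z = G z']) -> F x = G x.
Proof.
move=> cF cG H.
apply/eqP; rewrite -subr_eq0 -normr_le0; apply/ler_addgt0Pr => e e0; rewrite add0r.
have e2 : 0 < e / 2 by rewrite divr_gt0.
have /cvgrPdist_le/(_ _ e2) nF := cF; have /cvgrPdist_le/(_ _ e2) nG := cG.
have [z [z' [[Fz _] [_ Gz'] E]]] := H _ (filterI nF nG).
rewrite (le_trans (ler_distD (F z) _ _))// [leRHS]splitr lerD//.
by rewrite E distrC.
Qed.

(** Both mixed derivatives are mean values of the same second difference, hence
agree at two points close to x; a third derivative provides the continuity
needed to pass to the limit. *)
Lemma schwarz_scalar (U : set V) (f : V -> R) x v w : open U -> U x ->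
  diff_times 3 U f ->
  'D_w (fun y => 'D_v f y) x = 'D_v (fun y => 'D_w f y) x.
Proof.
move=> oU Ux [df Df].
have C u u' : {for x, continuous (fun z => 'D_u' (fun y => 'D_u f y) z)}.
  apply: differentiable_continuous.
  by have [_ /(_ u')[+ _]] := Df u; exact.
have Dd u y : U y -> differentiable (fun z => 'D_u f z) y.
  by move=> Uy; have [+ _] := Df u; exact.
apply: (continuous_meet_eq (C v w) (C w v)) => N Nx.
have /nbhs_ballP[r /= r0 Hr] : nbhs x (N `&` U).
  by apply: filterI => //; exact: open_nbhs_nbhs (conj oU Ux).
(* small enough for the parallelogram spanned by h v and h w to stay in the
   ball; the 1 keeps the denominator positive when v = w = 0 *)
pose h := r / (1 + `|v| + `|w|) / 2.
have N0 : 0 < 1 + `|v| + `|w| by rewrite -addrA ltr_wpDr// addr_ge0.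
have h0 : 0 < h by rewrite /h !divr_gt0.
have hr : h * (1 + `|v| + `|w|) < r.
  by rewrite /h mulrAC divfK ?gt_eqF// ltr_pdivrMr// ltr_pMr// ltr1n.
have Hb a b : `|b| + `|a| = `|w| + `|v| -> forall s t,
    s \in `[0, h] -> t \in `[0, h] -> (N `&` U) (t *: b + (s *: a + x)).
  move=> ab s t; rewrite !in_itv /= => /andP[s0 sh] /andP[t0 th]; apply: Hr.
  rewrite -ball_normE /= addrA [X in `|X|](_ : _ = - (t *: b + s *: a)); last first.
    by rewrite opprD addrCA subrr addr0.
  rewrite normrN; apply: (le_lt_trans (ler_normD _ _)); rewrite !normrZ !ger0_norm//.
  apply: le_lt_trans hr.
  apply: (@le_trans _ _ (h * (`|b| + `|a|))).
    by rewrite mulrDr lerD// ler_wpM2r.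
  by rewrite ab ler_wpM2l ?(ltW h0)// -addrA [`|w| + _]addrC lerDr.
have Hvw := Hb v w erefl; have Hwv := Hb w v (addrC _ _).
have [s [t [sh th E1]]] :=
  second_difference (ltW h0) (fun s t sh th => (Hvw s t sh th).2) df (Dd v).
have [s' [t' [sh' th' E2]]] :=
  second_difference (ltW h0) (fun s t sh th => (Hwv s t sh th).2) df (Dd w).
exists (t *: w + (s *: v + x)), (t' *: v + (s' *: w + x)); split.
- exact: (Hvw s t sh th).1.
- exact: (Hwv s' t' sh' th').1.
apply: (mulIf (lt0r_neq0 h0)); apply: (mulIf (lt0r_neq0 h0)).
apply: etrans (esym E1) _; apply: etrans _ E2.
rewrite [h *: v + (h *: w + x)]addrCA !opprB addrACA [RHS]addrACA.
by congr (_ + _); exact: addrC.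
Qed.

Lemma schwarz_row m (U : set V) (f : V -> 'rV[R]_m) x v w : open U -> U x ->
  diff_times 3 U f ->
  'D_w (fun y => 'D_v f y) x = 'D_v (fun y => 'D_w f y) x.
Proof.
move=> oU Ux df3; have [df Df] := df3; apply/rowP => j.
have dD u : differentiable (fun y => 'D_u f y) x by have [+ _] := Df u; exact.
apply: etrans (derive_entry w j (dD v)) _.
apply: etrans _ (esym (derive_entry v j (dD w))).
have E u u' : 'D_u' (fun y => 'D_u f y 0 j) x = 'D_u' (fun y => 'D_u (fun z => f z 0 j) y) x.
  apply: near_eq_derive; apply: (open_near_eq oU _ Ux) => y Uy.
  exact: derive_entry (df y Uy).
apply: etrans (E v w) _; apply: etrans _ (esym (E w v)).
apply: (@schwarz_scalar U (fun z => f z 0 j) x v w oU Ux).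
by have /(diff_times_row oU)/(_ j) := df3.
Qed.

End schwarz.

Section smooth.
Context {R : realType} {V : normedModType R} (U : set V) (oU : open U).
Implicit Types W : normedModType R.

Lemma smooth_differentiable W (f : V -> W) x :
  smooth_on U f -> U x -> differentiable f x.
Proof. by move=> sf Ux; have [+ _] := sf 1%N; exact. Qed.

Lemma smooth_derive W (f : V -> W) v : smooth_on U f -> smooth_on U (fun x => 'D_v f x).
Proof. by move=> sf k; have [_ /(_ v)] := sf k.+1. Qed.

Lemma eq_smooth W (f g : V -> W) : (forall x, U x -> f x = g x) ->
  smooth_on U f -> smooth_on U g.
Proof. by move=> fg sf k; exact: (eq_diff_times oU fg). Qed.

Lemma smooth_lin W (c : R) (f g : V -> W) :
  smooth_on U f -> smooth_on U g -> smooth_on U (fun x => c *: f x + g x).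
Proof. by move=> sf sg k; apply: diff_timesD => //; exact: diff_timesZ. Qed.

Lemma smooth_diff W (f : V -> W) v : smooth_on U f -> smooth_on U (fun x => 'd f x v).
Proof.
move=> sf; apply: (eq_smooth _ (smooth_derive v sf)) => x Ux.
by rewrite deriveE//; exact: smooth_differentiable sf Ux.
Qed.

Lemma derive_diff W (f : V -> W) u v x : smooth_on U f -> U x ->
  'D_u (fun z => 'd f z v) x = 'D_u (fun z => 'D_v f z) x.
Proof.
move=> sf Ux; apply: near_eq_derive; apply: (open_near_eq oU _ Ux) => z Uz.
by rewrite deriveE//; exact: smooth_differentiable sf Uz.
Qed.

End smooth.

(** * Bracket, exterior derivative and Lie derivative under a change of variables *)

Section local_calculus.
Context {R : realType} {m : nat}.
Local Notation E := 'rV[R]_m.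
Implicit Types (X Y : E -> E) (A : E -> E -> R) (x y v w : E).

(** The coordinate expressions of [X, Y], d A and L_X A on an open set of R^m.
A one-form is a function A of a constant vector first and of the point second, so
that A w is its component along w. *)
Definition bracket_at X Y x := 'D_(X x) Y x - 'D_(Y x) X x.
Definition d_at A x v w := 'D_v (A w) x - 'D_w (A v) x.
Definition lie_at X A x w := 'D_(X x) (A w) x + A ('D_w X x) x.

Section change.
Variables (O : set E) (phi : E -> E) (oO : open O) (sphi : smooth_on O phi).
Variables (y : E) (Oy : O y).

Lemma schwarz_at v w :
  'D_w (fun z => 'D_v phi z) y = 'D_v (fun z => 'D_w phi z) y.
Proof. exact: schwarz_row oO Oy (sphi 3). Qed.

(** For phi-related fields X and X', the derivative of X' picks up the Hessian of
phi in the directions w and X y.  Since it is symmetric in these directions, it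
cancels in every antisymmetrized expression. *)
Lemma related_derive X X' w :
  (forall z, O z -> X' (phi z) = 'd phi z (X z)) ->
  differentiable X y -> differentiable X' (phi y) ->
  'D_('d phi y w) X' (phi y) =
    'D_w (fun z => 'D_(X y) phi z) y + 'd phi y ('D_w X y).
Proof.
move=> rel dX dX'.
have dphi := smooth_differentiable sphi Oy.
have dB u : differentiable (fun z => 'd phi z u) y.
  by apply: smooth_differentiable Oy; exact: smooth_diff.
apply: etrans (congr1 (derive X' (phi y)) (esym (deriveE w dphi))) _.
apply: etrans (esym (derive_comp w dphi dX')) _.
apply: etrans (near_eq_derive w (open_near_eq oO rel Oy)) _.
have [|_ ->] := leibniz_family_row (B := fun z u => 'd phi z u) w _ dB dX.
  by move=> z; exact: linearP.
exact: (congr1 (fun u => u + _) (derive_diff oO w (X y) sphi Oy)).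
Qed.

Lemma related_bracket X X' Y Y' :
  (forall z, O z -> X' (phi z) = 'd phi z (X z)) ->
  (forall z, O z -> Y' (phi z) = 'd phi z (Y z)) ->
  differentiable X y -> differentiable X' (phi y) ->
  differentiable Y y -> differentiable Y' (phi y) ->
  bracket_at X' Y' (phi y) = 'd phi y (bracket_at X Y y).
Proof.
move=> relX relY dX dX' dY dY'; rewrite /bracket_at (relX y Oy) (relY y Oy).
rewrite (related_derive (Y y) relX dX dX') (related_derive (X y) relY dY dY').
rewrite (schwarz_at (Y y)) [in RHS]linearB opprD addrACA.
by rewrite [X in X + _]subrr add0r.
Qed.

Section form.
Variables (A A' : E -> E -> R).
Hypothesis linA' : forall x, linear (A' ^~ x).
Hypothesis relA : forall w z, O z -> A w z = A' ('d phi z w) (phi z).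
Hypothesis dA' : forall w, differentiable (A' w) (phi y).

(** The analogue for a pulled back one-form, with the same Hessian term. *)
Lemma related_derive_form v w : 'D_v (A w) y =
  'D_('d phi y v) (A' ('d phi y w)) (phi y) + A' ('D_v (fun z => 'D_w phi z) y) (phi y).
Proof.
have dphi := smooth_differentiable sphi Oy.
apply: etrans (near_eq_derive v (open_near_eq oO (@relA w) Oy)) _.
have dB u : differentiable (fun z => A' u (phi z)) y.
  exact: (@differentiable_comp _ _ _ _ phi (A' u)).
have dY : differentiable (fun z => 'd phi z w) y.
  by apply: smooth_differentiable Oy; exact: smooth_diff.
have [|_ ->] := leibniz_family (B := fun z u => A' u (phi z)) v _ dB dY.
  by move=> z; exact: linA'.
have E1 := etrans (@derive_comp _ _ _ _ phi (A' ('d phi y w)) _ v dphi (dA' _))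
  (congr1 (derive (A' ('d phi y w)) (phi y)) (deriveE v dphi)).
have E2 := congr1 (fun u => A' u (phi y)) (derive_diff oO v w sphi Oy).
exact: (congr2 +%R E1 E2).
Qed.

Lemma related_d v w : d_at A y v w = d_at A' (phi y) ('d phi y v) ('d phi y w).
Proof.
rewrite /d_at related_derive_form [X in _ - X]related_derive_form.
by rewrite (schwarz_at w v) opprD addrACA [X in _ + X]subrr addr0.
Qed.

Lemma related_lie X X' w :
  (forall z, O z -> X' (phi z) = 'd phi z (X z)) ->
  differentiable X y -> differentiable X' (phi y) ->
  lie_at X A y w = lie_at X' A' (phi y) ('d phi y w).
Proof.
move=> relX dX dX'; rewrite /lie_at (relX y Oy) (related_derive w relX dX dX').
rewrite related_derive_form (relA _ Oy) (schwarz_at w).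
have addA' u u' : A' (u + u') (phi y) = A' u (phi y) + A' u' (phi y).
  by have := linA' (phi y) 1 u u'; rewrite !scale1r.
by rewrite addA' -addrA.
Qed.

End form.
End change.
End local_calculus.

(** * Charts and coordinate changes *)

Section charts.
Context {R : realType} {m : nat} {M : manifold R m}.
Local Notation E := 'rV[R]_m.
Implicit Types (c d e : chart R m M) (p : M) (x y v w : E).
Implicit Types (X Y : vector_field M) (a : one_form M) (f : M -> R).

Lemma chart_invK c p : chart_dom c p -> chart_inv c (chart_map c p) = p.
Proof. by move=> cp; apply: chart_mapK; rewrite inE. Qed.

Lemma chart_img_map c p : chart_dom c p -> chart_img c (chart_map c p).
Proof. by move=> cp; exists p. Qed.

Lemma chart_map_inv c x : chart_img c x -> chart_map c (chart_inv c x) = x.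
Proof. by case=> p cp <-; rewrite chart_invK. Qed.

Lemma open_chart_img c : open (chart_img c).
Proof. exact: chart_img_open. Qed.

Definition transition c d : E -> E := chart_map d \o chart_inv c.
Definition overlap c d : set E := chart_map c @` (chart_dom c `&` chart_dom d).

Lemma overlapP c d x :
  overlap c d x <-> chart_img c x /\ chart_dom d (chart_inv c x).
Proof.
split => [[p [cp dp] <-]|[[p cp <-]]]; rewrite chart_invK//; last by exists p.
by split => //; exact: chart_img_map.
Qed.

Lemma overlap_map c d p : chart_dom c p -> chart_dom d p -> overlap c d (chart_map c p).
Proof. by move=> cp dp; exists p. Qed.

(** The chart inverse is only assumed continuous within its image; as the image is
open this is plain continuity there. *)
Lemma open_overlap c d : open (overlap c d).
Proof.
have -> : overlap c d = chart_img c `&` chart_inv c @^-1` (chart_dom d).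
  by apply/seteqP; split => x /overlapP.
have := @chart_inv_continuous _ _ _ c.
rewrite (continuous_open_subspace _ (@open_chart_img c)) => ci.
rewrite openE => x [cx dx]; apply: filterI.
  exact: open_nbhs_nbhs (conj (@open_chart_img c) cx).
apply: (ci x); first by rewrite inE.
exact: open_nbhs_nbhs (conj (@chart_dom_open _ _ _ d) dx).
Qed.

Lemma transition_smooth c d : atlas c -> atlas d ->
  smooth_on (overlap c d) (transition c d).
Proof. exact: atlas_compatible. Qed.

Lemma transition_map c d p : chart_dom c p -> transition c d (chart_map c p) = chart_map d p.
Proof. by move=> cp; rewrite /transition /= chart_invK. Qed.

Lemma inv_transition c d x : overlap c d x -> chart_inv d (transition c d x) = chart_inv c x.
Proof. by case/overlapP => cx dx; rewrite /transition /= chart_invK. Qed.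

(** Chain rule for transition maps: tangent vectors given in coordinates form a
well-defined tangent space. *)
Lemma coord_change_comp c d e p v : atlas c -> atlas d -> atlas e ->
  chart_dom c p -> chart_dom d p -> chart_dom e p ->
  coord_change d e p (coord_change c d p v) = coord_change c e p v.
Proof.
move=> ac ad ae cp dp ep; rewrite /coord_change.
have dcd := smooth_differentiable (transition_smooth ac ad) (overlap_map cp dp).
have dde := smooth_differentiable (transition_smooth ad ae) (overlap_map dp ep).
rewrite -[chart_map d p](transition_map d cp) in dde *.
have H : \forall x \near chart_map c p,
    (transition d e \o transition c d) x = transition c e x.
  apply: (open_near_eq (@open_overlap c d)); last exact: overlap_map.
  by move=> x xo /=; rewrite /transition /= chart_invK//; case/overlapP: xo.
have [_ E1] := near_eq_diff H (differentiable_comp dcd dde).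
exact: esym (congr1 (@^~ v) (etrans E1 (diff_comp dcd dde))).
Qed.

Lemma coord_change_id c p v : chart_dom c p -> coord_change c c p v = v.
Proof.
move=> cp; rewrite /coord_change.
have H : \forall x \near chart_map c p, id x = transition c c x.
  apply: (open_near_eq (@open_chart_img c)); last exact: chart_img_map.
  by move=> x cx /=; rewrite /transition /= chart_map_inv.
have [did idE] := is_diff_id (chart_map c p).
have [_ E1] := near_eq_diff H did.
exact: (congr1 (fun g : E -> E => g v) (etrans E1 idE)).
Qed.

Lemma coord_changeK c d p : atlas c -> atlas d -> chart_dom c p -> chart_dom d p ->
  cancel (coord_change c d p) (coord_change d c p).
Proof. by move=> ac ad cp dp v; rewrite coord_change_comp// coord_change_id. Qed.

End charts.

(** * Fields and forms in an arbitrary chart *)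

Section fields.
Context {R : realType} {m : nat} {M : manifold R m}.
Local Notation E := 'rV[R]_m.
Implicit Types (c d e : chart R m M) (p : M) (x y v w : E).
Implicit Types (X Y : vector_field M) (a : one_form M) (f : M -> R).

Lemma coord_change_linear c d p : linear (coord_change c d p).
Proof. exact: linearP. Qed.

Lemma local_form_linear c a x : linear (fun w => local_form c a w x).
Proof. by move=> k u v; rewrite /local_form coord_change_linear linearP. Qed.

Lemma local_vf_map c X p : chart_dom c p ->
  local_vf c X (chart_map c p) = coord_change (chart_at p) c p (X p).
Proof. by move=> cp; rewrite /local_vf chart_invK. Qed.

Lemma local_form_map c a w p : chart_dom c p ->
  local_form c a w (chart_map c p) = a p (coord_change c (chart_at p) p w).
Proof. by move=> cp; rewrite /local_form chart_invK. Qed.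

Lemma local_vf_at X p : local_vf (chart_at p) X (chart_map (chart_at p) p) = X p.
Proof. by rewrite local_vf_map ?coord_change_id//; exact: chart_at_dom. Qed.

Lemma local_form_at a w p :
  local_form (chart_at p) a w (chart_map (chart_at p) p) = a p w.
Proof. by rewrite local_form_map ?coord_change_id//; exact: chart_at_dom. Qed.

Lemma local_vf_transition c d X z : atlas c -> atlas d -> overlap d c z ->
  local_vf c X (transition d c z) = 'd (transition d c) z (local_vf d X z).
Proof.
move=> ac ad [q [dq cq] <-].
rewrite transition_map// !local_vf_map//; apply/esym.
apply: coord_change_comp => //; [exact: chart_at_atlas|exact: chart_at_dom].
Qed.

Lemma local_form_transition c d a w z : atlas c -> atlas d -> overlap d c z ->
  local_form d a w z =
  local_form c a ('d (transition d c) z w) (transition d c z).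
Proof.
move=> ac ad [q [dq cq] <-].
rewrite transition_map// !local_form_map//; apply/esym; congr (a q _).
apply: coord_change_comp => //; [exact: chart_at_atlas|exact: chart_at_dom].
Qed.

Lemma smooth_vf_differentiable c X p : smooth_vf X -> atlas c -> chart_dom c p ->
  differentiable (local_vf c X) (chart_map c p).
Proof.
move=> sX ac cp; apply: smooth_differentiable (sX c ac) _; exact: chart_img_map.
Qed.

Lemma smooth_form_differentiable c a w p :
  smooth_form a -> atlas c -> chart_dom c p ->
  differentiable (local_form c a w) (chart_map c p).
Proof.
move=> sa ac cp; apply: smooth_differentiable (sa c w ac) _; exact: chart_img_map.
Qed.

Section naturality.
Variables (c : chart R m M) (ac : atlas c) (p : M) (cp : chart_dom c p).
Let d := chart_at p.
Let ad : atlas d := chart_at_atlas p.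
Let dp : chart_dom d p := chart_at_dom p.
Let Oy : overlap d c (chart_map d p) := overlap_map dp cp.
Let sphi := transition_smooth ad ac.
Let oO := @open_overlap _ _ _ d c.
Let phiE : transition d c (chart_map d p) = chart_map c p := transition_map c dp.

Lemma lie_bracket_local X Y : smooth_vf X -> smooth_vf Y ->
  local_vf c (lie_bracket X Y) (chart_map c p) =
  bracket_at (local_vf c X) (local_vf c Y) (chart_map c p).
Proof.
move=> sX sY.
have dX := smooth_vf_differentiable sX ad dp.
have dY := smooth_vf_differentiable sY ad dp.
have dX' := smooth_vf_differentiable sX ac cp.
have dY' := smooth_vf_differentiable sY ac cp.
have rX z := @local_vf_transition c d X z ac ad.
have rY z := @local_vf_transition c d Y z ac ad.
rewrite -phiE in dX' dY'.
have B := related_bracket oO sphi Oy rX rY dX dX' dY dY'.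
have E1 : bracket_at (local_vf d X) (local_vf d Y) (chart_map d p) = lie_bracket X Y p :=
  congr2 (fun u u' => 'D_u (local_vf d Y) (chart_map d p) -
    'D_u' (local_vf d X) (chart_map d p)) (local_vf_at X p) (local_vf_at Y p).
rewrite phiE E1 in B; rewrite B; exact: local_vf_map.
Qed.

Lemma dform_local a v w : smooth_form a ->
  dform a p v w = d_at (local_form c a) (chart_map c p)
    (coord_change d c p v) (coord_change d c p w).
Proof.
move=> sa.
have da u := smooth_form_differentiable u sa ac cp.
have rA u z := @local_form_transition c d a u z ac ad.
rewrite -phiE in da.
have B := related_d oO sphi Oy (@local_form_linear c a) rA da v w.
by rewrite phiE in B; exact: B.
Qed.

Lemma lie_derivative_local X a w : smooth_vf X -> smooth_form a ->
  lie_derivative X a p w =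
  lie_at (local_vf c X) (local_form c a) (chart_map c p) (coord_change d c p w).
Proof.
move=> sX sa.
have da u := smooth_form_differentiable u sa ac cp.
have rA u z := @local_form_transition c d a u z ac ad.
have dX := smooth_vf_differentiable sX ad dp.
have dX' := smooth_vf_differentiable sX ac cp.
have rX z := @local_vf_transition c d X z ac ad.
rewrite -phiE in da dX'.
have B := related_lie oO sphi Oy (@local_form_linear c a) rA da w rX dX dX'.
rewrite phiE in B; apply: etrans B.
by rewrite /lie_at /lie_derivative local_vf_at local_form_at.
Qed.

Lemma dfun_local f v : smooth_functions M f ->
  dfun f p v = 'D_(coord_change d c p v) (f \o chart_inv c) (chart_map c p).
Proof.
move=> sf.
have df : differentiable (f \o chart_inv c) (chart_map c p).
  by apply: smooth_differentiable (sf c ac) _; exact: chart_img_map.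
have dphi := smooth_differentiable sphi Oy.
rewrite -phiE in df *.
have B := @derive_comp _ _ _ _ (transition d c) (f \o chart_inv c) _ v dphi df.
have E1 : \forall z \near chart_map d p,
    (f \o chart_inv d) z = (f \o chart_inv c) (transition d c z).
  by apply: (open_near_eq oO _ Oy) => z zO; rewrite /= (inv_transition zO).
apply: etrans (near_eq_derive v E1) _; apply: etrans B _.
exact: (congr1 (fun u => 'D_u (f \o chart_inv c) (transition d c (chart_map d p)))
  (deriveE v dphi)).
Qed.

Lemma pairing_local a X : local_form c a (local_vf c X (chart_map c p)) (chart_map c p)
  = a p (X p).
Proof.
rewrite local_form_map// local_vf_map//; congr (a p _).
exact: coord_changeK.
Qed.

End naturality.

Lemma smooth_pairing a X : smooth_form a -> smooth_vf X ->
  smooth_functions M (fun p => a p (X p)).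
Proof.
move=> sa sX c ac k.
apply: (eq_diff_times (@open_chart_img _ _ _ c) _
  (diff_times_family (B := fun x w => local_form c a w x) (@open_chart_img _ _ _ c)
     (@local_form_linear c a) (fun w => sa c w ac k) (sX c ac k))) => x [p cp <-].
by rewrite pairing_local//= chart_invK.
Qed.

Lemma smooth_dfun f X : smooth_functions M f -> smooth_vf X ->
  smooth_functions M (fun p => dfun f p (X p)).
Proof.
move=> sf sX c ac k.
have B := diff_times_family (B := fun x w => 'd (f \o chart_inv c) x w)
  (@open_chart_img _ _ _ c) (fun x => linearP _)
  (fun w => smooth_diff (@open_chart_img _ _ _ c) w (sf c ac) k) (sX c ac k).
apply: (eq_diff_times (@open_chart_img _ _ _ c) _ B) => x cx.
have df := smooth_differentiable (sf c ac) cx.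
apply: etrans (esym (deriveE _ df)) _; case: cx => p cp <-.
rewrite /= chart_invK//; apply/esym/(etrans (dfun_local ac cp _ sf)).
exact: (congr1 (fun u => 'D_u (f \o chart_inv c) (chart_map c p))
  (esym (local_vf_map X cp))).
Qed.

Lemma smooth_vf_bracket X Y : smooth_vf X -> smooth_vf Y -> smooth_vf (lie_bracket X Y).
Proof.
move=> sX sY c ac.
have H (Z Z' : vector_field M) : smooth_vf Z -> smooth_vf Z' ->
    smooth_on (chart_img c) (fun x => 'D_(local_vf c Z x) (local_vf c Z') x).
  move=> sZ sZ' k.
  have B := diff_times_family_row (B := fun x w => 'd (local_vf c Z') x w)
    (@open_chart_img _ _ _ c) (fun x => linearP _)
    (fun w => smooth_diff (@open_chart_img _ _ _ c) w (sZ' c ac) k) (sZ c ac k).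
  apply: (eq_diff_times (@open_chart_img _ _ _ c) _ B) => x cx.
  exact: esym (deriveE _ (smooth_differentiable (sZ' c ac) cx)).
have B := smooth_lin (@open_chart_img _ _ _ c) (-1) (H Y X sY sX) (H X Y sX sY).
apply: (eq_smooth (@open_chart_img _ _ _ c) _ B) => x [p cp <-].
by apply: etrans (esym (lie_bracket_local ac cp sX sY)); rewrite scaleN1r addrC.
Qed.

Lemma local_vf_lin c k X Y x :
  local_vf c (k *: X + Y) x = k *: local_vf c X x + local_vf c Y x.
Proof. exact: coord_change_linear. Qed.

Lemma smooth_vf_lin k X Y : smooth_vf X -> smooth_vf Y -> smooth_vf (k *: X + Y).
Proof.
move=> sX sY c ac.
apply: (eq_smooth (@open_chart_img _ _ _ c) _
  (smooth_lin (@open_chart_img _ _ _ c) k (sX c ac) (sY c ac))) => x _.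
by rewrite local_vf_lin.
Qed.

Lemma smooth_vf0 : smooth_vf (0 : vector_field M).
Proof.
move=> c ac; apply: (eq_smooth (@open_chart_img _ _ _ c) (f := fun=> 0)).
  by move=> x _; rewrite /local_vf /coord_change linear0.
by move=> k; apply: diff_times_cst; exact: open_chart_img.
Qed.

Lemma smooth_functions_lin k f g : smooth_functions M f -> smooth_functions M g ->
  smooth_functions M (k *: f + g).
Proof. by move=> sf sg c ac; exact: (smooth_lin (@open_chart_img _ _ _ c) k (sf c ac) (sg c ac)). Qed.

Lemma smooth_functions0 : smooth_functions M 0.
Proof.
by move=> c ac k; apply: diff_times_cst; exact: open_chart_img.
Qed.

End fields.

(** * Non-degeneracy from the wedge product *)

Section tensorial.
Context {R : realType} {m : nat}.
Local Notation E := 'rV[R]_m.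

(** The forms that are sums of products of linear functionals, that is, the
multilinear ones.  Column i of the matrix is the functional applied to the i-th
argument.  This presentation turns the alternating sum of the wedge product into
determinants. *)
Definition tensorial k (a : @Defs.form R E k) :=
  exists s : seq (R * 'M[R]_(m, k)),
    forall v, a v = \sum_(t <- s) t.1 * \prod_(i < k) (v i *m t.2) 0 i.

Lemma eq_tensorial k (a b : @Defs.form R E k) : a =1 b -> tensorial a -> tensorial b.
Proof. by move=> ab [s sE]; exists s => v; rewrite -ab. Qed.

Lemma tensorialZ k c (a : @Defs.form R E k) : tensorial a -> tensorial (fun v => c * a v).
Proof.
move=> [s sE]; exists [seq (c * t.1, t.2) | t <- s] => v.
by rewrite big_map sE mulr_sumr; apply: eq_bigr => t _; rewrite /= mulrA.
Qed.

Lemma tensorial_sum k (I : Type) (r : seq I) (F : I -> @Defs.form R E k) :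
  (forall i, tensorial (F i)) -> tensorial (fun v => \sum_(i <- r) F i v).
Proof.
move=> tF; elim: r => [|i r [s sE]]; first by exists [::] => v; rewrite !big_nil.
by have [si siE] := tF i; exists (si ++ s) => v; rewrite big_cons big_cat siE sE.
Qed.

Lemma tensorial_prod k l (a : @Defs.form R E k) (b : @Defs.form R E l) :
  tensorial a -> tensorial b -> tensorial (fun v : 'I_(k + l) -> E =>
    a (fun i => v (lshift l i)) * b (fun j => v (rshift k j))).
Proof.
move=> [s sE] [t tE].
exists [seq (x.1 * y.1, row_mx x.2 y.2) | x <- s, y <- t] => v.
rewrite sE tE big_distrl big_allpairs_dep /=; apply: eq_bigr => x _.
rewrite big_distrr /=; apply: eq_bigr => y _.
rewrite big_split_ord /= mulrACA; congr (_ * (_ * _)).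
  by apply: eq_bigr => i _; rewrite mul_mx_row row_mxEl.
by apply: eq_bigr => i _; rewrite mul_mx_row row_mxEr.
Qed.

Lemma tensorial_perm k (s : 'S_k) (a : @Defs.form R E k) :
  tensorial a -> tensorial (fun v => a (fun i => v (s i))).
Proof.
move=> [r rE]; exists [seq (t.1, col_perm s^-1%g t.2) | t <- r] => v.
rewrite rE big_map; apply: eq_bigr => t _ /=; congr (_ * _).
rewrite (reindex_inj (@perm_inj _ s^-1%g)); apply: eq_bigr => i _.
by rewrite permKV !mxE; apply: eq_bigr => j _; rewrite !mxE.
Qed.

Lemma tensorial_wedge k l (a : @Defs.form R E k) (b : @Defs.form R E l) :
  tensorial a -> tensorial b -> tensorial (wedge a b).
Proof.
move=> ta tb; apply: tensorialZ; apply: tensorial_sum => s; apply: tensorialZ.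
exact: (tensorial_perm s (tensorial_prod ta tb)).
Qed.

Lemma tensorial_wedge_pow (b : @Defs.form R E 2) n : tensorial b -> tensorial (wedge_pow b n).
Proof.
move=> tb; elim: n => [|n IH] /=; last exact: (tensorial_wedge tb IH).
by exists [:: (1, 0)] => v; rewrite big_seq1 /= mul1r big_ord0.
Qed.

Lemma linear_coord (f : E -> R) v : linear f -> f v = \sum_j v 0 j * f (delta_mx 0 j).
Proof. exact: linear_row_sum. Qed.

Lemma tensorial1 (f : E -> R) : linear f -> tensorial (fun u : 'I_1 -> E => f (u ord0)).
Proof.
move=> linf; exists [:: (1, \col_j f (delta_mx 0 j))] => v.
rewrite big_seq1 /= mul1r big_ord_recl big_ord0 mulr1 linear_coord// mxE.
by apply: eq_bigr => j _; rewrite mxE.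
Qed.

Lemma tensorial2 (b : E -> E -> R) : (forall w, linear (b ^~ w)) ->
  (forall v, linear (b v)) -> tensorial (fun u : 'I_2 -> E => b (u ord0) (u ord_max)).
Proof.
move=> linl linr.
have lin_coord j : linear (fun w : E => w 0 j) by move=> c x y; rewrite !mxE.
apply: (@eq_tensorial _ (fun u => \sum_i \sum_j b (delta_mx 0 i) (delta_mx 0 j) *
   (u (lshift 1 ord0) 0 i * u (rshift 1 ord0) 0 j))).
  move=> u; rewrite (linear_coord (u ord0) (linl _)); apply: eq_bigr => i _.
  rewrite (linear_coord (u ord_max) (linr _)) mulr_sumr; apply: eq_bigr => j _.
  have -> : lshift 1 (ord0 : 'I_1) = ord0 by exact: val_inj.
  have -> : rshift 1 (ord0 : 'I_1) = ord_max by exact: val_inj.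
  by rewrite [LHS]mulrCA [in LHS](mulrC (b _ _)).
apply: tensorial_sum => i; apply: tensorial_sum => j; apply: tensorialZ.
exact: (tensorial_prod (tensorial1 (lin_coord i)) (tensorial1 (lin_coord j))).
Qed.

(** The alternating sum of a product of k functionals on k vectors is the
determinant of their values, a matrix which factors through the vectors; it is
singular as soon as the vectors lie in the image of a map of rank less than
k. *)
Lemma alternate_degenerate k (a : @Defs.form R E k) (P : 'M[R]_m) (v : 'I_k -> E) :
  tensorial a -> (\rank P < k)%N ->
  \sum_(s : 'S_k) (-1) ^+ s * a (fun i => v (s i) *m P) = 0.
Proof.
move=> [r rE] rP.
under eq_bigr do rewrite rE mulr_sumr.
rewrite exchange_big /= big1_seq// => t _.
pose D := (\matrix_i v i) *m (P *m t.2).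
rewrite (eq_bigr (fun s : 'S_k => t.1 * ((-1) ^+ s * \prod_i D^T i (s i)))); last first.
  move=> s _; rewrite mulrCA; congr (_ * (_ * _)); apply: eq_bigr => i _.
  have -> : D^T i (s i) = (row (s i) D) 0 i by rewrite !mxE.
  by rewrite /D row_mul rowK mulmxA.
rewrite -mulr_sumr -/(\det _) det_tr.
have -> : \det D = 0; last by rewrite mulr0.
apply/eqP; rewrite -[_ == 0]negbK -unitfE -unitmxE -row_full_unit.
apply/negP => /eqP rD; move: rP; rewrite ltnNge => /negP; apply.
by rewrite -[leqLHS]rD /D (leq_trans (mxrankM_maxr _ _))// mxrankM_maxl.
Qed.

Lemma wedge_pow_pullback (b : @Defs.form R E 2) (P : E -> E) n v :
  (forall u, b (fun i => P (u i)) = b u) ->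
  wedge_pow b n (fun i => P (v i)) = wedge_pow b n v.
Proof.
move=> bP; elim: n v => //= n IH v; rewrite /wedge; congr (_ * _).
apply: eq_bigr => s _; congr (_ * (_ * _)).
  exact: (bP (fun i => v (s (lshift (n * 2) i)))).
exact: (IH (fun j => v (s (rshift 2 j)))).
Qed.

(** Suppose that z <> 0 is killed by al and be.  The projection P along z onto a
coordinate hyperplane then leaves al and be unchanged, so the wedge product
takes the same value on a family and on its image under P, where it vanishes
for lack of dimension. *)
Lemma wedge_nondegenerate n (al : E -> R) (be : E -> E -> R) (z : E) :
  (m <= 1 + n * 2)%N ->
  linear al -> (forall w, linear (be ^~ w)) -> (forall v, linear (be v)) ->
  (exists v, wedge (fun u : 'I_1 -> E => al (u ord0))
     (wedge_pow (fun u => be (u ord0) (u ord_max)) n) v != 0) ->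
  al z = 0 -> (forall w, be z w = 0) -> (forall w, be w z = 0) -> z = 0.
Proof.
move=> mn linal linl linr [v vN0] alz bez bez'.
apply/eqP/negPn/negP => /rV0Pn[j zj].
pose P : 'M[R]_m := 1%:M - (z 0 j)^-1 *: ((delta_mx j 0 : 'cV[R]_m) *m z).
have PE u : u *m P = (- (u 0 j / z 0 j)) *: z + u.
  rewrite mulmxBr mulmx1 -scalemxAr mulmxA -[u *m _]colE.
  rewrite [col j u]mx11_scalar mul_scalar_mx mxE scalerA scaleNr addrC.
  by rewrite [X in - (X *: _)]mulrC.
have rP : (\rank P < 1 + n * 2)%N.
  apply: leq_trans mn; rewrite ltn_neqAle rank_leq_row andbT.
  apply/negP => /eqP rP; have /row_freeP[Q PQ] : row_free P by apply/eqP.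
  have zP : z *m P = 0 by rewrite PE divff// scaleN1r addNr.
  move: zj; rewrite -[z]mulmx1 -PQ mulmxA zP mul0mx mxE eqxx //.
have alP u : al (u *m P) = al u by rewrite PE linal alz scaler0 add0r.
have beP u w : be (u *m P) (w *m P) = be u w.
  by rewrite !PE linr bez' scaler0 add0r linl bez scaler0 add0r.
move/negP: vN0; apply; apply/eqP.
set W := wedge_pow _ n.
pose F : @Defs.form R E (1 + n * 2) :=
  fun v => al (v (lshift (n * 2) ord0)) * W (fun j => v (rshift 1 j)).
have tF : tensorial F.
  apply: (tensorial_prod (tensorial1 linal)); apply: tensorial_wedge_pow.
  exact: tensorial2.
rewrite /wedge [X in _ * X](_ : _ = \sum_(s : 'S_(1 + n * 2)) (-1) ^+ s * F (fun i => v (s i) *m P)).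
  by rewrite alternate_degenerate ?mulr0.
apply: eq_bigr => s _; rewrite /F alP; congr (_ * (_ * _)); apply: esym.
apply: (@wedge_pow_pullback _ (fun u => u *m P) n (fun j => v (s (rshift 1 j)))).
by move=> u; exact: beP.
Qed.

End tensorial.

(** * Linear algebra of a one-form and a two-form without common kernel *)

Section contact_pair.
Context {R : realType} {m : nat}.
Local Notation E := 'rV[R]_m.
Variables (al : E -> R) (be : E -> E -> R).
Hypotheses (linal : linear al) (linl : forall w, linear (be ^~ w)).
Hypotheses (linr : forall v, linear (be v)) (anti : forall v w, be v w = - be w v).
Hypothesis nondeg : forall z, al z = 0 -> (forall w, be z w = 0) -> z = 0.

(** The matrix of u |-> al(u) al + be(u, .), acting on row vectors. *)
Definition gram : 'M[R]_m :=
  \matrix_(i, j) (al (delta_mx 0 i) * al (delta_mx 0 j) + be (delta_mx 0 i) (delta_mx 0 j)).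

Lemma linear_eq (f g : E -> R) : linear f -> linear g ->
  (forall j, f (delta_mx 0 j) = g (delta_mx 0 j)) -> f =1 g.
Proof.
move=> linf ling fg v; rewrite (linear_coord v linf) (linear_coord v ling).
by apply: eq_bigr => j _; rewrite fg.
Qed.

Lemma mul_gram u j : (u *m gram) 0 j = al u * al (delta_mx 0 j) + be u (delta_mx 0 j).
Proof.
rewrite mxE (linear_coord u linal) (linear_coord u (linl _)) mulr_suml -big_split /=.
by apply: eq_bigr => i _; rewrite !mxE mulrDr mulrA.
Qed.

Lemma be_diag v : be v v = 0.
Proof. by have := anti v v; lra. Qed.

Let linalM k x y : al (k *: x + y) = k * al x + al y.
Proof. exact: linal. Qed.

Let linrM v k x y : be v (k *: x + y) = k * be v x + be v y.
Proof. exact: linr. Qed.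

Let scaleM (k x : R) : k *: x = k * x.
Proof. by []. Qed.

(** If v is in the kernel, evaluating at v gives al(v)^2 = 0, so that v is killed
by both al and be. *)
Lemma gram_det : \det gram != 0.
Proof.
apply/negP => /det0P[v v0 vG].
have H w : al v * al w + be v w = 0.
  apply: (linear_eq (f := fun w => al v * al w + be v w) (g := fun=> 0)).
  - by move=> k x y; rewrite linalM linrM scaleM; ring.
  - by move=> k x y; rewrite scaler0 addr0.
  - by move=> j; rewrite -mul_gram vG mxE.
have alv : al v = 0.
  by have := H v; rewrite be_diag addr0 => /eqP; rewrite mulf_eq0 orbb => /eqP.
move/negP: v0; apply; apply/eqP; apply: nondeg => // w.
by have := H w; rewrite alv mul0r add0r.
Qed.

(** An antisymmetric matrix B of odd size satisfies det B = - det B, hence has a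
kernel vector; al does not vanish on it, so it can be normalized. *)
Lemma exists_reeb_vector : odd m -> exists r, al r = 1 /\ forall w, be r w = 0.
Proof.
move=> oddm.
pose B : 'M[R]_m := \matrix_(i, j) be (delta_mx 0 i) (delta_mx 0 j).
have BT : B^T = (-1) *: B.
  by apply/matrixP => i j; rewrite !mxE mulN1r; exact: anti.
have /eqP/det0P[v v0 vB] : \det B = 0.
  by have := det_tr B; rewrite BT detZ -signr_odd oddm expr1; lra.
have bev w : be v w = 0.
  apply: (linear_eq (f := be v) (g := fun=> 0) (linr v)).
    by move=> k x y; rewrite scaler0 addr0.
  move=> j; rewrite (linear_coord v (linl _)).
  have : (v *m B) 0 j = 0 by rewrite vB mxE.
  by rewrite mxE => vBj; apply: etrans vBj; apply: eq_bigr => i _; rewrite mxE.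
have alv : al v != 0 by apply: contra v0 => /eqP alv; apply/eqP/nondeg.
have alZ k u : al (k *: u) = k * al u.
  by rewrite -[k *: u]addr0 linal (_ : al 0 = 0) ?addr0// (linear_coord 0 linal)
    big1// => j _; rewrite mxE mul0r.
exists ((al v)^-1 *: v); split; first by rewrite alZ mulVf.
move=> w; rewrite anti -[_ *: v]addr0 linr (anti w v) bev oppr0 scaler0 add0r.
by rewrite (linear_coord 0 (linr w)) big1 ?oppr0// => j _; rewrite mxE mul0r.
Qed.

(** The solution X of al(X) al + be(X, .) = h al + ga solves the two equations
separately, because r isolates the first one: be and ga vanish on r. *)
Lemma solve_contact_pair (h : R) (ga : E -> R) r : linear ga ->
  al r = 1 -> (forall w, be r w = 0) -> ga r = 0 ->
  exists X, al X = h /\ forall v, be X v = ga v.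
Proof.
move=> linga alr ber gar.
have lingaM k x y : ga (k *: x + y) = k * ga x + ga y by exact: linga.
pose b : E := \row_j (h * al (delta_mx 0 j) + ga (delta_mx 0 j)).
pose X := b *m invmx gram; exists X.
have XG : X *m gram = b by rewrite mulmxKV// unitmxE unitfE gram_det.
have H w : al X * al w + be X w = h * al w + ga w.
  apply: (linear_eq (f := fun w => al X * al w + be X w)
    (g := fun w => h * al w + ga w)).
  - by move=> k x y; rewrite linalM linrM scaleM; ring.
  - by move=> k x y; rewrite linalM lingaM scaleM; ring.
  - by move=> j; rewrite -mul_gram XG mxE.
have alX : al X = h.
  by have := H r; rewrite alr (anti X) ber gar oppr0 !addr0 !mulr1.
by split => // v; have := H v; rewrite alX => /addrI.
Qed.

Lemma contact_pair_inj X X' : al X = al X' -> (forall v, be X v = be X' v) -> X = X'.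
Proof.
move=> alE beE; apply/eqP; rewrite -subr_eq0 -[X]scale1r addrC -scaleN1r scale1r.
apply/eqP; apply: nondeg => [|w]; first by rewrite linal alE scaleN1r addNr.
by rewrite (linl w (-1)) beE scaleN1r addNr.
Qed.

End contact_pair.

(** * Second-order identities on an open set *)

Section local_identities.
Context {R : realType} {m : nat}.
Local Notation E := 'rV[R]_m.
Variables (U : set E) (oU : open U) (x : E) (Ux : U x).
Implicit Types (X Y Z : E -> E) (v w : E).

(** With X variable, D_X Y is a product of the differential of Y and of X, so its
derivative consists of a second derivative of Y and of a first derivative of X. *)
Lemma derive_along X Y v : smooth_on U X -> smooth_on U Y ->
  differentiable (fun y => 'D_(X y) Y y) x /\
  'D_v (fun y => 'D_(X y) Y y) x =
    'D_v (fun y => 'D_(X x) Y y) x + 'D_('D_v X x) Y x.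
Proof.
move=> sX sY.
have dX := smooth_differentiable sX Ux; have dY := smooth_differentiable sY Ux.
have dB w : differentiable (fun y => 'd Y y w) x.
  by apply: smooth_differentiable Ux; exact: smooth_diff.
have [df fE] := leibniz_family_row (B := fun y w => 'd Y y w) v
  (fun y => linearP _) dB dX.
have E1 : forall y, U y -> 'd Y y (X y) = 'D_(X y) Y y.
  by move=> y Uy; exact: esym (deriveE _ (smooth_differentiable sY Uy)).
split; first exact: near_eq_differentiable (open_near_eq oU E1 Ux) df.
apply: etrans (esym (near_eq_derive v (open_near_eq oU E1 Ux))) _.
apply: etrans fE _.
exact: (congr2 +%R (derive_diff oU v (X x) sY Ux) (esym (deriveE _ dY))).
Qed.

Lemma derive_along_scalar X (f : E -> R) v : smooth_on U X -> smooth_on U f ->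
  differentiable (fun y => 'D_(X y) f y) x /\
  'D_v (fun y => 'D_(X y) f y) x =
    'D_v (fun y => 'D_(X x) f y) x + 'D_('D_v X x) f x.
Proof.
move=> sX sf.
have dX := smooth_differentiable sX Ux; have df := smooth_differentiable sf Ux.
have dB w : differentiable (fun y => 'd f y w) x.
  by apply: smooth_differentiable Ux; exact: smooth_diff.
have [dg gE] := leibniz_family (B := fun y w => 'd f y w) v
  (fun y => linearP _) dB dX.
have E1 : forall y, U y -> 'd f y (X y) = 'D_(X y) f y.
  by move=> y Uy; exact: esym (deriveE _ (smooth_differentiable sf Uy)).
split; first exact: near_eq_differentiable (open_near_eq oU E1 Ux) dg.
apply: etrans (esym (near_eq_derive v (open_near_eq oU E1 Ux))) _.
apply: etrans gE _.
exact: (congr2 +%R (derive_diff oU v (X x) sf Ux) (esym (deriveE _ df))).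
Qed.

Lemma derive_bracket X Y v : smooth_on U X -> smooth_on U Y ->
  'D_v (bracket_at X Y) x =
    ('D_v (fun y => 'D_(X x) Y y) x + 'D_('D_v X x) Y x) -
    ('D_v (fun y => 'D_(Y x) X y) x + 'D_('D_v Y x) X x).
Proof.
move=> sX sY.
have [d1 E1] := derive_along v sX sY; have [d2 E2] := derive_along v sY sX.
rewrite -[bracket_at X Y]/((fun y => 'D_(X y) Y y) - (fun y => 'D_(Y y) X y)).
apply: etrans (deriveB (diff_derivable (v := v) d1) (diff_derivable (v := v) d2)) _.
exact: (congr2 (fun a b => a - b) E1 E2).
Qed.

Lemma double_bracket X Y Z : smooth_on U X -> smooth_on U Y -> smooth_on U Z ->
  bracket_at X (bracket_at Y Z) x =
    ('D_(X x) (fun y => 'D_(Y x) Z y) x + 'D_('D_(X x) Y x) Z x) -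
    ('D_(X x) (fun y => 'D_(Z x) Y y) x + 'D_('D_(X x) Z x) Y x) -
    ('D_('D_(Y x) Z x) X x - 'D_('D_(Z x) Y x) X x).
Proof.
move=> sX sY sZ; have dX := smooth_differentiable sX Ux.
exact: (congr2 (fun a b => a - b) (derive_bracket (X x) sY sZ) (deriveBdir _ _ dX)).
Qed.

(** hX, hY, hZ stand for the Hessians of the three fields on the two others, and
xyz for the derivative of Z along D_X Y. *)
Let cyclic_cancel (hX hY hZ xyz yzx zxy xzy yxz zyx : E) :
  (hZ + xyz - (hY + xzy) - (yzx - zyx)) +
  (hX + yzx - (hZ + yxz) - (zxy - xzy)) +
  (hY + zxy - (hX + zyx) - (xyz - yxz)) = 0.
Proof. by apply/rowP => j; rewrite !mxE; ring. Qed.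

Lemma bracket_jacobi X Y Z : smooth_on U X -> smooth_on U Y -> smooth_on U Z ->
  bracket_at X (bracket_at Y Z) x + bracket_at Y (bracket_at Z X) x +
  bracket_at Z (bracket_at X Y) x = 0.
Proof.
move=> sX sY sZ.
pose S (f : E -> E) (sf : smooth_on U f) v w := schwarz_row v w oU Ux (sf 3%N).
have E1 := double_bracket sX sY sZ; have E2 := double_bracket sY sZ sX.
have E3 := double_bracket sZ sX sY.
have {}E2 := etrans E2 (congr1 (fun h => _ + _ - (h + _) - _) (S Z sZ (X x) (Y x))).
have {}E3 := etrans E3 (congr2 (fun h h' => h + _ - (h' + _) - _)
  (S Y sY (X x) (Z x)) (S X sX (Y x) (Z x))).
have E := congr2 +%R (congr2 +%R E1 E2) E3.
by apply: etrans E _; exact: cyclic_cancel.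
Qed.

Section conformal.
Variable A : E -> E -> R.
Hypothesis linA : forall y, linear (A ^~ y).
Hypothesis sA : forall w, smooth_on U (A w).

Lemma derive_lie X v w : smooth_on U X ->
  'D_v (fun y => lie_at X A y w) x =
    ('D_v (fun y => 'D_(X x) (A w) y) x + 'D_('D_v X x) (A w) x) +
    ('D_v (A ('D_w X x)) x + A ('D_v (fun y => 'D_w X y) x) x).
Proof.
move=> sX; have [d1 E1] := derive_along_scalar v sX (sA w).
have [d2 E2] := leibniz_family (B := fun y u => A u y) v linA
  (fun u => smooth_differentiable (sA u) Ux)
  (smooth_differentiable (smooth_derive w sX) Ux).
rewrite -[fun y => _]/((fun y => 'D_(X y) (A w) y) + (fun y => A ('D_w X y) y)).
apply: etrans (deriveD (diff_derivable (v := v) d1) (diff_derivable (v := v) d2)) _.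
exact: (congr2 +%R E1 E2).
Qed.

(** h is the Hessian of A w on X and Y; p1, p2 and q1, ..., q4 are the terms of
L_[X,Y] A at w; s2, t1 are the two terms of L_X A at w and s1, t2 those of L_Y A;
r1 and r2 differentiate A, along Y and X, at the fixed vectors D_w X and D_w Y. *)
Let contact_cancel (p1 p2 q1 q2 q3 q4 h a xnu ymu mu nu r1 r2 s1 s2 t1 t2 : R) :
  (h + p2) + (r1 + q3) = mu * s1 + a * ymu ->
  (h + p1) + (r2 + q1) = nu * s2 + a * xnu ->
  r1 + q2 = nu * t1 -> r2 + q4 = mu * t2 ->
  s2 + t1 = mu * a -> s1 + t2 = nu * a ->
  (p1 - p2) + ((q1 + q2) - (q3 + q4)) = (xnu - ymu) * a.
Proof.
move=> e1 e2 e3 e4 e5 e6.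
have -> : (p1 - p2) + ((q1 + q2) - (q3 + q4)) =
  ((h + p1) + (r2 + q1)) - ((h + p2) + (r1 + q3)) + (r1 + q2) - (r2 + q4) by ring.
rewrite e1 e2 e3 e4.
have -> : t1 = mu * a - s2 by rewrite -e5; ring.
have -> : t2 = nu * a - s1 by rewrite -e6; ring.
ring.
Qed.

(** Differentiate L_X A = mu A along Y and L_Y A = nu A along X and subtract.  The
Hessian of A w cancels.  The terms with a derivative of X or Y inside A are
removed with the two equations taken at D_w X and D_w Y, and the products of
mu with nu cancel. *)
Lemma lie_bracket_contact X Y (mu nu : E -> R) w :
  smooth_on U X -> smooth_on U Y -> smooth_on U mu -> smooth_on U nu ->
  (forall y v, U y -> lie_at X A y v = mu y * A v y) ->
  (forall y v, U y -> lie_at Y A y v = nu y * A v y) ->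
  lie_at (bracket_at X Y) A x w = ('D_(X x) nu x - 'D_(Y x) mu x) * A w x.
Proof.
move=> sX sY smu snu eX eY.
have dAw := smooth_differentiable (sA w) Ux.
have side (Z : E -> E) (rho : E -> R) v : smooth_on U Z -> smooth_on U rho ->
    (forall y u, U y -> lie_at Z A y u = rho y * A u y) ->
    ('D_v (fun y => 'D_(Z x) (A w) y) x + 'D_('D_v Z x) (A w) x) +
    ('D_v (A ('D_w Z x)) x + A ('D_v (fun y => 'D_w Z y) x) x) =
    rho x * 'D_v (A w) x + A w x * 'D_v rho x.
  move=> sZ srho eZ; apply: etrans (esym (derive_lie v w sZ)) _.
  apply: etrans (near_eq_derive v (open_near_eq oU (fun y => eZ y w) Ux)) _.
  have drho := smooth_differentiable srho Ux.
  exact: (deriveM (diff_derivable (v := v) drho) (diff_derivable (v := v) dAw)).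
have addA u u' : A (u + u') x = A u x + A u' x.
  by have := linA x 1 u u'; rewrite !scale1r.
have subA u u' : A (u - u') x = A u x - A u' x.
  rewrite [u - u']addrC -[- u']scaleN1r; apply: etrans (linA x (-1) u' u) _.
  by rewrite scaleN1r addrC.
have e1 := side X mu (Y x) sX smu eX.
have e2 := side Y nu (X x) sY snu eY.
have sw (f : E -> E) (sf : smooth_on U f) v : A ('D_v (fun y => 'D_w f y) x) x =
    A ('D_w (fun y => 'D_v f y) x) x.
  exact: (congr1 (fun u => A u x) (schwarz_row w v oU Ux (sf 3%N))).
have {}e1 := etrans (congr1 (fun q => _ + (_ + q)) (esym (sw X sX (Y x)))) e1.
have {}e2 := etrans (congr2 (fun h q => h + _ + (_ + q))
  (schwarz_scalar (X x) (Y x) oU Ux (sA w 3%N)) (esym (sw Y sY (X x)))) e2.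
have C := contact_cancel e1 e2 (eY x ('D_w X x) Ux) (eX x ('D_w Y x) Ux)
  (eX x w Ux) (eY x w Ux).
apply: etrans _ C; apply: (congr2 +%R); first exact: deriveBdir.
apply: etrans (congr1 (fun u => A u x) (derive_bracket w sX sY)) _.
by apply: etrans (subA _ _) _; apply: (congr2 (fun a b => a - b)); exact: addA.
Qed.

End conformal.
End local_identities.

(** * Smooth solutions of linear systems *)

Section cramer.
Context {R : realType} {V : normedModType R} (U : set V) (oU : open U).

Lemma smooth_det n (G : V -> 'M[R]_n) :
  (forall i j, smooth_on U (fun x => G x i j)) -> smooth_on U (fun x => \det (G x)).
Proof.
move=> sG k; apply: diff_times_sum => // s _; apply: diff_timesM => //.
  exact: diff_times_cst.
by apply: diff_times_prod => // i _; exact: sG.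
Qed.

(** Cramer's rule: the adjugate and the determinant are polynomial in the
coefficients, so the entries of the inverse matrix are smooth. *)
Lemma smooth_solve m (G : V -> 'M[R]_m) (b Y : V -> 'rV[R]_m) :
  (forall i j, smooth_on U (fun x => G x i j)) ->
  (forall x, U x -> \det (G x) != 0) -> smooth_on U b ->
  (forall x, U x -> Y x *m G x = b x) -> smooth_on U Y.
Proof.
move=> sG G0 sb YG k; apply/(diff_times_row oU) => j.
have sdet : smooth_on U (fun x => \det (G x)) by exact: smooth_det.
have S : diff_times k U
    (fun x => \sum_i b x 0 i * ((\det (G x))^-1 * \adj (G x) i j)).
  apply: diff_times_sum => // i _; apply: diff_timesM => //.
    by have /(diff_times_row oU)/(_ i) := sb k.
  apply: diff_timesM => //; first exact: diff_timesV.
  apply: (eq_diff_times oU (f := fun x => (-1) ^+ (j + i) *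
     \det (\matrix_(k, l) G x (lift j k) (lift i l)))).
    move=> x _; rewrite mxE /cofactor; congr (_ * \det _).
    by apply/matrixP => k' l; rewrite !mxE.
  apply: diff_timesM => //; first exact: diff_times_cst.
  apply: (@smooth_det _ (fun x => \matrix_(k, l) G x (lift j k) (lift i l))) => k' l.
  by apply: (eq_smooth oU _ (sG (lift j k') (lift i l))) => x _; rewrite mxE.
apply: (eq_diff_times oU _ S) => x Ux.
have Gu : G x \in unitmx by rewrite unitmxE unitfE G0.
rewrite -[Y x](mulmxK Gu) YG// mxE; apply: eq_bigr => i _.
by rewrite /invmx Gu !mxE.
Qed.

End cramer.

(** * Linearity of the exterior derivative *)

Section exterior.
Context {R : realType} {m : nat}.
Local Notation E := 'rV[R]_m.
Variables (A : E -> E -> R) (x : E).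
Hypothesis linA : forall y, linear (A ^~ y).
Hypothesis dA : forall w, differentiable (A w) x.

Lemma d_at_anti v w : d_at A x v w = - d_at A x w v.
Proof. by rewrite /d_at opprB. Qed.

Lemma d_at_linearl w : linear (fun v => d_at A x v w).
Proof.
move=> k u v; rewrite /d_at.
have E1 : 'D_(k *: u + v) (A w) x = k *: 'D_u (A w) x + 'D_v (A w) x.
  exact: derive_lindir.
have E2 : 'D_w (A (k *: u + v)) x = k *: 'D_w (A u) x + 'D_w (A v) x.
  have -> : A (k *: u + v) = k *: A u + A v by apply/funext => y; exact: linA.
  have du := diff_derivable (v := w) (dA u); have dv := diff_derivable (v := w) (dA v).
  have T := deriveD (@derivableZ _ _ _ (A u) k x w du) dv.
  exact: (etrans T (congr1 (fun t => t + _) (@deriveZ _ _ _ (A u) k x w du))).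
apply: etrans (congr2 (fun a b => a - b) E1 E2) _.
by rewrite scalerBr opprD addrACA.
Qed.

Lemma d_at_linearr v : linear (d_at A x v).
Proof.
move=> k u w; rewrite !(d_at_anti v) d_at_linearl.
by rewrite opprD scalerN.
Qed.

End exterior.

(** * Calculus of vector fields on a manifold *)

Section manifold_calculus.
Context {R : realType} {m : nat} {M : manifold R m}.
Local Notation E := 'rV[R]_m.
Implicit Types (c d e : chart R m M) (p : M) (x y v w : E).
Implicit Types (X Y Z : vector_field M) (a : one_form M) (f g : M -> R).

Lemma dform_anti a p v w : dform a p v w = - dform a p w v.
Proof. exact: d_at_anti. Qed.

Lemma dform_linearl a p w : smooth_form a -> linear (fun v => dform a p v w).
Proof.
move=> sa; apply: (@d_at_linearl _ _ (local_form (chart_at p) a)).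
  exact: local_form_linear.
move=> u; apply: smooth_form_differentiable => //; [exact: chart_at_atlas|exact: chart_at_dom].
Qed.

Lemma dform_linearr a p v : smooth_form a -> linear (dform a p v).
Proof.
move=> sa; apply: (@d_at_linearr _ _ (local_form (chart_at p) a)).
  exact: local_form_linear.
move=> u; apply: smooth_form_differentiable => //; [exact: chart_at_atlas|exact: chart_at_dom].
Qed.

Lemma dfun_differentiable f c p : smooth_functions M f -> atlas c -> chart_dom c p ->
  differentiable (f \o chart_inv c) (chart_map c p).
Proof.
by move=> sf ac cp; apply: smooth_differentiable (sf c ac) _; exact: chart_img_map.
Qed.

Lemma dfun_linear f p : smooth_functions M f -> linear (dfun f p).
Proof.
move=> sf k u v; apply: derive_lindir; apply: dfun_differentiable => //.
  exact: chart_at_atlas.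
exact: chart_at_dom.
Qed.

(** In the chart, d(alpha(X)) expands by the Leibniz rule into the derivative of
alpha, which cancels one half of d alpha, and the derivative of X, which is the
second term of the Lie derivative. *)
Lemma cartan X a p w : smooth_vf X -> smooth_form a ->
  lie_derivative X a p w = dform a p (X p) w + dfun (fun q => a q (X q)) p w.
Proof.
move=> sX sa; pose c := chart_at p.
have ac : atlas c by exact: chart_at_atlas.
have cp : chart_dom c p by exact: chart_at_dom.
pose y := chart_map c p.
have E1 : forall z, chart_img c z ->
    local_form c a (local_vf c X z) z = a (chart_inv c z) (X (chart_inv c z)).
  by move=> z [q cq <-]; rewrite chart_invK// pairing_local.
have [_ E2] := leibniz_family (B := fun z u => local_form c a u z) w
  (@local_form_linear _ _ _ c a) (fun u => smooth_form_differentiable u sa ac cp)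
  (smooth_vf_differentiable sX ac cp).
have E3 := etrans (esym (near_eq_derive w
  (open_near_eq (@open_chart_img _ _ _ c) E1 (chart_img_map cp)))) E2.
rewrite [dfun _ _ _]E3 /lie_derivative /dform local_vf_at local_form_at.
by rewrite addrA subrK.
Qed.

Lemma lie_bracket_at X Y p : lie_bracket X Y p =
  bracket_at (local_vf (chart_at p) X) (local_vf (chart_at p) Y)
    (chart_map (chart_at p) p).
Proof.
exact: esym (congr2 (fun u u' =>
  'D_u (local_vf (chart_at p) Y) (chart_map (chart_at p) p) -
  'D_u' (local_vf (chart_at p) X) (chart_map (chart_at p) p))
  (local_vf_at X p) (local_vf_at Y p)).
Qed.

(** Unlike the definition of the bracket, this holds with the same chart c at all
points of its image, so it can be differentiated. *)
Lemma local_vf_bracket c X Y x : atlas c -> chart_img c x ->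
  smooth_vf X -> smooth_vf Y ->
  local_vf c (lie_bracket X Y) x = bracket_at (local_vf c X) (local_vf c Y) x.
Proof. by move=> ac [p cp <-] sX sY; exact: lie_bracket_local. Qed.

Lemma eq_bracket_at (W Z Z' : E -> E) x (U : set E) : open U -> U x ->
  (forall y, U y -> Z y = Z' y) -> bracket_at W Z x = bracket_at W Z' x.
Proof.
move=> oU Ux ZZ'.
exact: (congr2 (fun s u => s - 'D_u W x) (near_eq_derive _ (open_near_eq oU ZZ' Ux))
  (ZZ' x Ux)).
Qed.

Lemma lie_bracket_jacobi X Y Z : smooth_vf X -> smooth_vf Y -> smooth_vf Z ->
  lie_bracket X (lie_bracket Y Z) + lie_bracket Y (lie_bracket Z X) +
  lie_bracket Z (lie_bracket X Y) = 0.
Proof.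
move=> sX sY sZ; apply/funext => p; pose c := chart_at p.
have ac : atlas c by exact: chart_at_atlas.
have cp : chart_img c (chart_map c p) by apply: chart_img_map; exact: chart_at_dom.
have H (X1 X2 X3 : vector_field M) : smooth_vf X2 -> smooth_vf X3 ->
    lie_bracket X1 (lie_bracket X2 X3) p = bracket_at (local_vf c X1)
      (bracket_at (local_vf c X2) (local_vf c X3)) (chart_map c p).
  move=> s2 s3; apply: etrans (lie_bracket_at _ _ _) _.
  apply: (eq_bracket_at _ (@open_chart_img _ _ _ c) cp).
  by move=> y cy; exact: local_vf_bracket.
apply: etrans (bracket_jacobi (@open_chart_img _ _ _ c) cp (sX c ac) (sY c ac) (sZ c ac)).
exact: (congr2 +%R (congr2 +%R (H _ _ _ sY sZ) (H _ _ _ sZ sX)) (H _ _ _ sX sY)).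
Qed.

Lemma lie_bracketxx X : lie_bracket X X = 0.
Proof. by apply/funext => p; exact: subrr. Qed.

Lemma lie_bracket_anti X Y : lie_bracket X Y = - lie_bracket Y X.
Proof. by apply/funext => p; exact: esym (opprB _ _). Qed.

Lemma derive_local_vf_lin c k X Y p w : atlas c -> chart_dom c p ->
  smooth_vf X -> smooth_vf Y ->
  'D_w (local_vf c (k *: X + Y)) (chart_map c p) =
  k *: 'D_w (local_vf c X) (chart_map c p) + 'D_w (local_vf c Y) (chart_map c p).
Proof.
move=> ac cp sX sY.
have -> : local_vf c (k *: X + Y) = k *: local_vf c X + local_vf c Y.
  by apply/funext => x; exact: local_vf_lin.
have dX := diff_derivable (v := w) (smooth_vf_differentiable sX ac cp).
have dY := diff_derivable (v := w) (smooth_vf_differentiable sY ac cp).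
have T := deriveD (@derivableZ _ _ _ (local_vf c X) k _ w dX) dY.
exact: (etrans T (congr1 (fun t => t + _) (@deriveZ _ _ _ (local_vf c X) k _ w dX))).
Qed.

Lemma lie_bracket_linr k X Y Z : smooth_vf X -> smooth_vf Y -> smooth_vf Z ->
  lie_bracket Z (k *: X + Y) = k *: lie_bracket Z X + lie_bracket Z Y.
Proof.
move=> sX sY sZ; apply/funext => p.
have ac := chart_at_atlas p; have cp := chart_at_dom p.
have E1 := derive_local_vf_lin k (Z p) ac cp sX sY.
have E2 := derive_lindir k (X p) (Y p) (smooth_vf_differentiable sZ ac cp).
apply: etrans (congr2 (fun s t => s - t) E1 E2) _.
rewrite opprD addrACA; congr (_ + _).
by rewrite -[RHS]/(k *: (_ - _)) scalerBr.
Qed.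

Lemma lie_bracket_linl k X Y Z : smooth_vf X -> smooth_vf Y -> smooth_vf Z ->
  lie_bracket (k *: X + Y) Z = k *: lie_bracket X Z + lie_bracket Y Z.
Proof.
move=> sX sY sZ; rewrite lie_bracket_anti lie_bracket_linr// opprD -scalerN.
by rewrite (lie_bracket_anti X) (lie_bracket_anti Y).
Qed.

Lemma lie_derivative_lin k X Y a p w : smooth_vf X -> smooth_vf Y -> smooth_form a ->
  lie_derivative (k *: X + Y) a p w =
  k * lie_derivative X a p w + lie_derivative Y a p w.
Proof.
move=> sX sY sa.
have ac := chart_at_atlas p; have cp := chart_at_dom p.
have E1 := derive_local_vf_lin k w ac cp sX sY.
have E2 := derive_lindir k (X p) (Y p) (smooth_form_differentiable w sa ac cp).
apply: etrans (congr2 (fun s t => s + a p t) E2 E1) _.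
rewrite linearP addrACA; congr (_ + _).
by rewrite [RHS]mulrDr.
Qed.

Lemma lie_derivative0 a p w : lie_derivative 0 a p w = 0.
Proof.
have E1 : 'D_w (local_vf (chart_at p) (0 : vector_field M)) (chart_map (chart_at p) p) = 0.
  have -> : local_vf (chart_at p) (0 : vector_field M) = cst 0.
    by apply/funext => x; exact: linear0.
  exact: derive_cst.
apply: etrans (congr2 (fun s t => s + a p t) (derive0 _ _) E1) _.
by rewrite add0r linear0.
Qed.

(** The conformal equations for X and Y hold at every point, each in the
preferred chart of that point; expressed in the single chart at p they can be
differentiated there. *)
Lemma lie_bracket_conformal X Y a mu nu p w :
  smooth_form a -> smooth_vf X -> smooth_vf Y ->
  smooth_functions M mu -> smooth_functions M nu ->
  (forall q v, lie_derivative X a q v = mu q * a q v) ->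
  (forall q v, lie_derivative Y a q v = nu q * a q v) ->
  lie_derivative (lie_bracket X Y) a p w =
    (dfun nu p (X p) - dfun mu p (Y p)) * a p w.
Proof.
move=> sa sX sY smu snu eX eY; pose c := chart_at p.
have ac : atlas c by exact: chart_at_atlas.
have cp : chart_dom c p by exact: chart_at_dom.
have oc := @open_chart_img _ _ _ c.
have loc (Z : vector_field M) rho : smooth_vf Z ->
    (forall q v, lie_derivative Z a q v = rho q * a q v) -> forall z v, chart_img c z ->
    lie_at (local_vf c Z) (local_form c a) z v =
      (rho \o chart_inv c) z * local_form c a v z.
  move=> sZ eZ z v [q cq <-]; rewrite /= chart_invK// local_form_map// -eZ.
  rewrite (lie_derivative_local ac cq _ sZ sa) coord_changeK//.
    exact: chart_at_atlas.
  exact: chart_at_dom.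
have L := lie_bracket_contact oc (chart_img_map cp) (@local_form_linear _ _ _ c a)
  (fun u => sa c u ac) w (sX c ac) (sY c ac) (smu c ac) (snu c ac)
  (loc X mu sX eX) (loc Y nu sY eY).
have E0 : forall z, chart_img c z -> local_vf c (lie_bracket X Y) z =
    bracket_at (local_vf c X) (local_vf c Y) z.
  by move=> z cz; exact: local_vf_bracket.
have E1 := near_eq_derive w (open_near_eq oc E0 (chart_img_map cp)).
have E2 : lie_derivative (lie_bracket X Y) a p w =
    lie_at (bracket_at (local_vf c X) (local_vf c Y)) (local_form c a) (chart_map c p) w.
  apply: etrans (congr2 (fun u t => 'D_u (local_form c a w) (chart_map c p) + a p t)
     (lie_bracket_at X Y p) E1) _.
  exact: (congr1 (fun t => _ + t) (esym (local_form_at a _ p))).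
apply: etrans E2 (etrans L _).
apply: etrans (congr2 (fun u u' => ('D_u (nu \o chart_inv c) (chart_map c p) -
  'D_u' (mu \o chart_inv c) (chart_map c p)) * _) (local_vf_at X p) (local_vf_at Y p)) _.
exact: (congr1 (fun t => _ * t) (local_form_at a w p)).
Qed.

End manifold_calculus.

(** * Contact Hamiltonian fields *)

Section contact.
Context {R : realType} {n : nat} {M : manifold R n.*2.+1}.
Local Notation E := 'rV[R]_(n.*2.+1).
Variables (a : one_form M) (ca : contact_form a).
Implicit Types (X Y Z : vector_field M) (p : M) (v w : E) (f g h mu : M -> R).

Let sa : smooth_form a := ca.1.

Lemma contact_nondegenerate p z : a p z = 0 -> (forall w, dform a p z w = 0) -> z = 0.
Proof.
move=> az daz; apply: (wedge_nondegenerate (n := n) _ _ _ _ (ca.2 p)) => //.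
- by rewrite add1n muln2.
- exact: linearP.
- by move=> w; exact: dform_linearl.
- by move=> v; exact: dform_linearr.
- by move=> w; rewrite dform_anti daz oppr0.
Qed.

(** In every chart the components of X solve al(X) al + be(X, .) = h al + ga, a
linear system whose invertible matrix and right-hand side are smooth. *)
Lemma smooth_vf_of_contractions X h (ga : M -> E -> R) :
  smooth_functions M h ->
  (forall c w, atlas c -> smooth_on (chart_img c) (fun x => let p := chart_inv c x in
     ga p (coord_change c (chart_at p) p w))) ->
  (forall p, a p (X p) = h p) -> (forall p v, dform a p (X p) v = ga p v) ->
  smooth_vf X.
Proof.
move=> sh sga aX daX c ac.
have oc := @open_chart_img _ _ _ c.
pose al x w := local_form c a w x.
pose be x := d_at (local_form c a) x.
have dA x w : chart_img c x -> differentiable (local_form c a w) x.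
  by move=> cx; exact: smooth_differentiable (sa w ac) cx.
pose b x : E := \row_j (h (chart_inv c x) * al x (delta_mx 0 j) +
  ga (chart_inv c x) (coord_change c (chart_at (chart_inv c x)) (chart_inv c x)
    (delta_mx 0 j))).
apply: (@smooth_solve _ _ _ oc _ (fun x => gram (al x) (be x)) b).
- move=> i j; apply: (eq_smooth oc (f := fun x =>
    al x (delta_mx 0 i) * al x (delta_mx 0 j) +
    ('D_(delta_mx 0 i) (local_form c a (delta_mx 0 j)) x +
     -1 * 'D_(delta_mx 0 j) (local_form c a (delta_mx 0 i)) x))).
    by move=> x _; rewrite mxE mulN1r.
  move=> k; apply: diff_timesD => //; first by apply: diff_timesM => //; exact: sa.
  apply: diff_timesD => //; first by apply: smooth_derive; exact: sa.
  apply: diff_timesM => //; first exact: diff_times_cst.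
  by apply: smooth_derive; exact: sa.
- move=> x cx; apply: gram_det.
  + exact: local_form_linear.
  + by move=> w; apply: d_at_linearl; [exact: local_form_linear|move=> u; exact: dA].
  + by move=> v; apply: d_at_linearr; [exact: local_form_linear|move=> u; exact: dA].
  + by move=> v w; exact: d_at_anti.
  + case: cx => p cp <- z; rewrite /al local_form_map// => az bez.
    have ap := chart_at_atlas p; have dp := chart_at_dom p.
    suff z0 : coord_change c (chart_at p) p z = 0.
      by rewrite -(coord_changeK ac ap cp dp z) z0; exact: linear0.
    apply: (@contact_nondegenerate p) => // w.
    by rewrite (dform_local ac cp _ _ sa) coord_changeK.
- move=> k; apply/(diff_times_row oc) => j.
  apply: (eq_diff_times oc (f := fun x => (h \o chart_inv c) x *
     local_form c a (delta_mx 0 j) x + (let p := chart_inv c x in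
     ga p (coord_change c (chart_at p) p (delta_mx 0 j))))).
    by move=> x _; rewrite mxE.
  apply: diff_timesD => //; last exact: sga.
  by apply: diff_timesM => //; [exact: sh|exact: sa].
- move=> x [p cp <-]; apply/rowP => j.
  have ap := chart_at_atlas p; have dp := chart_at_dom p.
  rewrite mul_gram; last 2 first.
  + exact: local_form_linear.
  + move=> w; apply: d_at_linearl; [exact: local_form_linear|move=> u; apply: dA].
    exact: chart_img_map.
  rewrite mxE chart_invK// /al (pairing_local ac cp) aX; congr (_ + _).
  rewrite -daX (dform_local ac cp _ _ sa) coord_changeK// local_vf_map//.
Qed.

Lemma exists_reeb : exists X, is_reeb a X.
Proof.
have H p : exists r, a p r = 1 /\ forall w, dform a p r w = 0.
  apply: exists_reeb_vector.
  - exact: linearP.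
  - by move=> w; exact: dform_linearl.
  - by move=> v; exact: dform_linearr.
  - by move=> v w; exact: dform_anti.
  - exact: contact_nondegenerate.
  - by rewrite /= odd_double.
have [X HX] := choice H; exists X; split.
- apply: (@smooth_vf_of_contractions X (fun=> 1) (fun _ _ => 0)).
  + by move=> c ac k; apply: diff_times_cst; exact: open_chart_img.
  + by move=> c w ac k; apply: diff_times_cst; exact: open_chart_img.
  + by move=> p; exact: (HX p).1.
  + by move=> p; exact: (HX p).2.
- by move=> p; exact: (HX p).2.
- by move=> p; exact: (HX p).1.
Qed.

Lemma reeb_is_reeb : is_reeb a (reeb a).
Proof. exact: (xgetPex _ exists_reeb). Qed.

Lemma exists_hamiltonian f : smooth_functions M f ->
  exists X, is_contact_hamiltonian a f X.
Proof.
move=> sf; have [sr dr ar] := reeb_is_reeb.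
pose ga p v := dfun f p (reeb a p) * a p v - dfun f p v.
have H p : exists u : E, a p u = f p /\ forall v, dform a p u v = ga p v.
  apply: (@solve_contact_pair _ _ (a p) (dform a p) _ _ _ _ _ _ _ (reeb a p)).
  - exact: linearP.
  - by move=> w; exact: dform_linearl.
  - by move=> v; exact: dform_linearr.
  - by move=> v w; exact: dform_anti.
  - exact: contact_nondegenerate.
  - move=> k u v; rewrite /ga linearP (dfun_linear p sf).
    by rewrite -![_ *: (_ : R)]/(_ * _); ring.
  - exact: ar.
  - exact: dr.
  - by rewrite /ga ar mulr1 subrr.
have [X HX] := choice H; exists X; split.
- apply: (@smooth_vf_of_contractions X f ga) => //.
  + move=> c w ac k; have oc := @open_chart_img _ _ _ c.
    apply: (eq_diff_times oc (f := fun x =>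
      ((fun p => dfun f p (reeb a p)) \o chart_inv c) x * local_form c a w x +
      -1 * 'D_w (f \o chart_inv c) x)).
      move=> x [p cp <-]; rewrite mulN1r; congr (_ - _).
      rewrite /= chart_invK// (dfun_local ac cp)// coord_changeK//.
      + exact: chart_at_atlas.
      + exact: chart_at_dom.
    apply: diff_timesD => //.
      by apply: diff_timesM => //; [exact: smooth_dfun|exact: sa].
    apply: diff_timesM => //; first exact: diff_times_cst.
    by apply: smooth_derive; exact: sf.
  + by move=> p; exact: (HX p).1.
  + by move=> p; exact: (HX p).2.
- by move=> p; exact: (HX p).1.
- by move=> p; exact: (HX p).2.
Qed.

Lemma contact_hamiltonianP f : smooth_functions M f ->
  is_contact_hamiltonian a f (contact_hamiltonian a f).
Proof. by move=> sf; exact: (xgetPex _ (exists_hamiltonian sf)). Qed.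

Lemma contact_hamiltonian_unique f X : smooth_functions M f ->
  is_contact_hamiltonian a f X -> contact_hamiltonian a f = X.
Proof.
move=> sf [sX aX dX]; have [sY aY dY] := contact_hamiltonianP sf.
apply/funext => p; apply: (@contact_pair_inj _ _ (a p) (dform a p)).
- exact: linearP.
- by move=> w; exact: dform_linearl.
- exact: contact_nondegenerate.
- by rewrite aX aY.
- by move=> v; rewrite dX dY.
Qed.

Lemma hamiltonian_contact f : smooth_functions M f ->
  contact_vector_fields a (contact_hamiltonian a f).
Proof.
move=> sf; have [sX aX dX] := contact_hamiltonianP sf; split => //.
have [sr _ _] := reeb_is_reeb.
exists (fun p => dfun f p (reeb a p)); first exact: smooth_dfun.
move=> p w; rewrite cartan// dX.
have -> : (fun q => a q (contact_hamiltonian a f q)) = f by apply/funext.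
by rewrite subrK.
Qed.

(** The conformal factor mu is forced: at the Reeb vector the left-hand side of
d alpha(X, .) = mu alpha - d(alpha(X)) vanishes. *)
Lemma contact_is_hamiltonian X : contact_vector_fields a X ->
  contact_hamiltonian a (fun p => a p (X p)) = X.
Proof.
move=> [sX [mu smu LX]]; have sf := smooth_pairing sa sX.
apply: (contact_hamiltonian_unique sf); split => // p v.
have [_ dr ar] := reeb_is_reeb.
have H w : dform a p (X p) w = mu p * a p w - dfun (fun q => a q (X q)) p w.
  by rewrite -LX cartan// addrK.
rewrite H; congr (_ * _ - _).
by have := H (reeb a p); rewrite dform_anti dr oppr0 ar mulr1 => /esym/subr0_eq.
Qed.

Lemma contact_lin (k : R) X Y : contact_vector_fields a X -> contact_vector_fields a Y ->
  contact_vector_fields a (k *: X + Y).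
Proof.
move=> [sX [mu smu LX]] [sY [nu snu LY]]; split; first exact: smooth_vf_lin.
exists (k *: mu + nu); first exact: smooth_functions_lin.
move=> p w; rewrite lie_derivative_lin// LX LY.
by rewrite -[(k *: mu + nu) p]/(k * mu p + nu p) mulrDl mulrA.
Qed.

Lemma contact_bracket X Y : contact_vector_fields a X -> contact_vector_fields a Y ->
  contact_vector_fields a (lie_bracket X Y).
Proof.
move=> [sX [mu smu LX]] [sY [nu snu LY]]; split; first exact: smooth_vf_bracket.
exists (-1 *: (fun p => dfun mu p (Y p)) + (fun p => dfun nu p (X p))).
  by apply: smooth_functions_lin; exact: smooth_dfun.
move=> p w; rewrite (lie_bracket_conformal _ _ sa sX sY smu snu LX LY).
by congr (_ * _); rewrite -[RHS]/(-1 * _ + _) mulN1r addrC.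
Qed.

Lemma contact_lie_algebra : lie_algebra (contact_vector_fields a) lie_bracket.
Proof.
split.
- split; first exact: smooth_vf0.
  exists 0; first exact: smooth_functions0.
  by move=> p w; rewrite lie_derivative0 mul0r.
- exact: contact_lin.
- exact: contact_bracket.
- by move=> k X Y Z [sX _] [sY _] [sZ _]; exact: lie_bracket_linl.
- by move=> k X Y Z [sX _] [sY _] [sZ _]; exact: lie_bracket_linr.
- by move=> X _; exact: lie_bracketxx.
- by move=> X Y Z [sX _] [sY _] [sZ _]; exact: lie_bracket_jacobi.
Qed.

Lemma contact_hamiltonian_lin (k : R) f g :
  smooth_functions M f -> smooth_functions M g ->
  contact_hamiltonian a (k *: f + g) =
  k *: contact_hamiltonian a f + contact_hamiltonian a g.
Proof.
move=> sf sg; have [_ af _] := contact_hamiltonianP sf.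
have [_ ag _] := contact_hamiltonianP sg.
rewrite -[RHS]contact_is_hamiltonian; last first.
  by apply: contact_lin; exact: hamiltonian_contact.
congr (contact_hamiltonian a _); apply/funext => p.
by apply: etrans _ (esym (linearP (a p) k _ _)); rewrite af ag.
Qed.

(** [X_f, X_g] is contact, hence is the Hamiltonian field of its own contraction
with alpha. *)
Lemma contact_hamiltonian_bracket f g :
  smooth_functions M f -> smooth_functions M g ->
  contact_hamiltonian a (jacobi_bracket a f g) =
  lie_bracket (contact_hamiltonian a f) (contact_hamiltonian a g).
Proof.
move=> sf sg; apply: contact_is_hamiltonian.
by apply: contact_bracket; exact: hamiltonian_contact.
Qed.

Lemma smooth_jacobi_bracket f g : smooth_functions M f -> smooth_functions M g ->
  smooth_functions M (jacobi_bracket a f g).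
Proof.
move=> sf sg; apply: smooth_pairing => //; apply: smooth_vf_bracket.
- by have [] := contact_hamiltonianP sf.
- by have [] := contact_hamiltonianP sg.
Qed.

(** Each axiom is the one for vector fields contracted with alpha; the iterated
bracket of functions is handled by rewriting the Hamiltonian field of the inner
one as a Lie bracket. *)
Lemma jacobi_lie_algebra : lie_algebra (smooth_functions M) (jacobi_bracket a).
Proof.
have sH f (sf : smooth_functions M f) : smooth_vf (contact_hamiltonian a f).
  by have [] := contact_hamiltonianP sf.
split.
- exact: smooth_functions0.
- by move=> k f g; exact: smooth_functions_lin.
- exact: smooth_jacobi_bracket.
- move=> k f g h sf sg sh; apply/funext => p.
  rewrite /jacobi_bracket contact_hamiltonian_lin// lie_bracket_linl; try exact: sH.
  exact: linearP.
- move=> k f g h sf sg sh; apply/funext => p.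
  rewrite /jacobi_bracket contact_hamiltonian_lin// lie_bracket_linr; try exact: sH.
  exact: linearP.
- by move=> f _; apply/funext => p; rewrite /jacobi_bracket lie_bracketxx linear0.
- move=> f g h sf sg sh; apply/funext => p.
  have J := lie_bracket_jacobi (sH f sf) (sH g sg) (sH h sh).
  have jE f1 f2 f3 (s2 : smooth_functions M f2) (s3 : smooth_functions M f3) :
      jacobi_bracket a f1 (jacobi_bracket a f2 f3) p = a p (lie_bracket
        (contact_hamiltonian a f1)
        (lie_bracket (contact_hamiltonian a f2) (contact_hamiltonian a f3)) p) :=
    congr1 (fun X => a p (lie_bracket (contact_hamiltonian a f1) X p))
      (contact_hamiltonian_bracket s2 s3).
  apply: etrans (congr2 +%R (congr2 +%R (jE f g h sg sh) (jE g h f sh sf))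
    (jE h f g sf sg)) _.
  apply: etrans _ (etrans (congr1 (fun X : vector_field M => a p (X p)) J) (linear0 _)).
  by rewrite /= -!linearD.
Qed.

End contact.

Theorem proposition3p1p9 (R : realType) (n : nat) (M : manifold R n.*2.+1)
    (alpha : one_form M) (halpha : contact_form alpha) :
  lie_isomorphism (smooth_functions M) (jacobi_bracket alpha)
    (contact_vector_fields alpha) lie_bracket (contact_hamiltonian alpha).
Proof.
split.
- exact: jacobi_lie_algebra.
- exact: contact_lie_algebra.
- split.
  + by move=> f sf; exact: hamiltonian_contact.
  + move=> f g /set_mem sf /set_mem sg fg; apply/funext => p.
    have [_ <- _] := contact_hamiltonianP halpha sf.
    by have [_ <- _] := contact_hamiltonianP halpha sg; rewrite fg.
  + move=> X cX; exists (fun p => alpha p (X p)); last exact: contact_is_hamiltonian.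
    by have [sX _] := cX; apply: smooth_pairing => //; exact: halpha.1.
- exact: contact_hamiltonian_lin.
- exact: contact_hamiltonian_bracket.
Qed.
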